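(* Let $F=(f_1,\ldots,f_J)$, $J\geq 2$, be an iterated function system consisting of similarities of $\mathbb{R}^d$, with $f_j(\mathbb{Q}^d)\subseteq\mathbb{Q}^d$ for $1\leq j\leq J$, and let $C$ be its attractor, assumed to contain more than one point. Let $\tau_j\in(0,1)$ be the contraction factor of $f_j$, $\tau=\max_{1\leq j\leq J}\tau_j$, and $D=-\log J/\log\tau$. Assume that either $F$ satisfies the open set condition and there is a nonzero vector $\underline{v}\in\mathbb{Z}^d$ such that $C$ contains no line segment parallel to $\underline{v}$, or that $D<1/2$. Then: (1) There exists $K>0$ such that for any $\underline{\xi}\in C$ and any $Q>1$ the inequality $$\Vert\underline{\xi}-\underline{p}/q\Vert\leq\frac{K}{Q}$$ has a solution $\underline{p}/q\in\mathbb{Q}^d\setminus C$ with $1\leq q\leq Q$. (2) For any function $\Phi:\mathbb{N}\to(0,\infty)$ that tends to $0$, there exists $\underline{\xi}\in C\setminus\mathbb{Q}^d$ for which there are arbitrarily large $Q$ such that $$\Vert\underline{\xi}-\underline{p}/q\Vert>\frac{\Phi(Q)}{Q}$$ holds for every $\underline{p}/q\in\mathbb{Q}^d\setminus C$ with $1\leq q\leq Q$. (3) For any function $\Psi:\mathbb{N}\to(0,\infty)$, there are intrinsically $\Psi$-approximable vectors in $C$, i.e. vectors $\underline{\xi}\in C$ for which the inequality $$\Vert\underline{\xi}-\underline{p}/q\Vert<\Psi(q)$$ admits infinitely many solutions $\underline{p}/q\in\mathbb{Q}^d\cap C$. In particular, $C$ contains Liouville vectors.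
   Context: $\mathbb{R}^d$ carries the supremum norm $\Vert\cdot\Vert$. A contracting similarity with contraction factor $\tau_j\in(0,1)$ is a map with $\Vert f_j(\underline{x})-f_j(\underline{y})\Vert=\tau_j\Vert\underline{x}-\underline{y}\Vert$ for all $\underline{x},\underline{y}\in\mathbb{R}^d$. The attractor of a finite family (IFS) of contractions $f_1,\ldots,f_J$ is the unique nonempty compact set $C$ with $\bigcup_{j}f_j(C)=C$. The IFS satisfies the open set condition if there is a nonempty bounded open set $O\subseteq\mathbb{R}^d$ with $f_j(O)\subseteq O$ for all $j$ and $f_i(O)\cap f_j(O)=\emptyset$ for $i\neq j$. Line segments are nondegenerate. Rational vectors are written $\underline{p}/q$ with $\underline{p}\in\mathbb{Z}^d$, $q\in\mathbb{N}$; infinitely many solutions means infinitely many distinct rational vectors. A vector $\underline{\xi}\in\mathbb{R}^d$ is a Liouville vector if for every $N$ the inequality $\Vert\underline{\xi}-\underline{p}/q\Vert<q^{-N}$ has infinitely many solutions $\underline{p}/q\in\mathbb{Q}^d$. *)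

(* Defs.v *)
From HB Require Import structures.
From mathcomp Require Import all_boot all_order all_algebra.
From mathcomp Require Import all_classical all_reals all_analysis.

Set Implicit Arguments.
Unset Strict Implicit.
Unset Printing Implicit Defensive.

Import Order.TTheory GRing.Theory Num.Theory.
Import numFieldNormedType.Exports.

Local Open Scope classical_set_scope.
Local Open Scope ring_scope.

(* Throughout, R^d is 'rV[R]_d, whose library norm `|x| is the supremum norm
   (mx_normrE), with the induced topology. *)

(* [p] need not be coprime to [q]; it is used for [0 < q] only. *)
Definition ratvec (R : realType) (d : nat) (p : 'rV[int]_d) (q : nat) :
    'rV[R]_d :=
  q%:R^-1 *: map_mx intr p.

Definition rational_vectors (R : realType) (d : nat) : set 'rV[R]_d :=
  range (map_mx ratr : 'rV[rat]_d -> 'rV[R]_d).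
Arguments rational_vectors R d : clear implicits.

Definition contracting_similarity (R : realType) (d : nat) (t : R)
    (f : 'rV[R]_d -> 'rV[R]_d) : Prop :=
  0 < t < 1 /\ forall x y, `|f x - f y| = t * `|x - y|.

Definition is_attractor (R : realType) (d J : nat)
    (f : 'I_J -> 'rV[R]_d -> 'rV[R]_d) (C : set 'rV[R]_d) : Prop :=
  [/\ C !=set0, compact C & \bigcup_j (f j @` C) = C].

Definition open_set_condition (R : realType) (d J : nat)
    (f : 'I_J -> 'rV[R]_d -> 'rV[R]_d) : Prop :=
  exists O : set 'rV[R]_d,
    [/\ O !=set0, bounded_set O, open O,
        forall j, f j @` O `<=` O &
        forall i j, i != j -> (f i @` O) `&` (f j @` O) = set0].

Definition line_segment (R : realType) (d : nat) (a b : 'rV[R]_d) :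
    set 'rV[R]_d :=
  [set a + t *: (b - a) | t in `[0, 1]%classic].

Definition contains_segment_parallel (R : realType) (d : nat)
    (C : set 'rV[R]_d) (v : 'rV[R]_d) : Prop :=
  exists a b : 'rV[R]_d,
    [/\ a != b, exists l : R, b - a = l *: v & line_segment a b `<=` C].

(* A set of vectors, so that different representations p/q of one rational
   vector count as a single solution. *)
Definition approximations (R : realType) (d : nat) (Psi : nat -> R)
    (xi : 'rV[R]_d) : set 'rV[R]_d :=
  [set r | exists (p : 'rV[int]_d) (q : nat),
    [/\ (0 < q)%N, r = ratvec R p q & `|xi - ratvec R p q| < Psi q]].

Definition intrinsically_approximable (R : realType) (d : nat)
    (C : set 'rV[R]_d) (Psi : nat -> R) (xi : 'rV[R]_d) : Prop :=
  C xi /\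
  infinite_set (approximations Psi xi `&` (rational_vectors R d `&` C)).

Definition liouville_vector (R : realType) (d : nat) (xi : 'rV[R]_d) : Prop :=
  forall N : nat, infinite_set (approximations (fun q => q%:R ^- N) xi).

(* Main.v *)
Require Import Defs.
From HB Require Import structures.
From mathcomp Require Import all_boot all_order all_algebra.
From mathcomp Require Import all_classical all_reals all_analysis.
From mathcomp Require Import zify ring lra.

Set Implicit Arguments.
Unset Strict Implicit.
Unset Printing Implicit Defensive.

Import Order.TTheory GRing.Theory Num.Theory.
Import numFieldNormedType.Exports.

Local Open Scope classical_set_scope.
Local Open Scope ring_scope.

(* A similarity of (R^d, sup norm) is onto (compactness) and hence affine
   (Mazur-Ulam), so a rational contracting similarity has a rational fixed
   point; as C is not a singleton it contains two rational points, and their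
   images in small cylinders show that the rational points of C form a set
   without isolated points that is dense in C. Nested balls around rational
   points y = a/b of C, of radii shrinking arbitrarily fast in terms of b, yield
   irrational points of C that are approximated as well as one likes from inside
   C; this is (3), and (2) follows because a rational vector p/q other than y is
   at distance at least 1/(bq) from y.

   For (1) one needs a rational vector outside C with denominator of order Q at
   distance O(1/Q). Under the open set condition, boundedly many cylinders of
   size rho meet a segment of length of order rho; a segment parallel to v
   contains a proportional subsegment missing a given cylinder, since the linear
   parts are signed permutations up to scaling and so, by compactness, finitely
   many directions have to be considered. Hence C is uniformly porous along v.
   If D < 1/2, consider a cover of C by J^m cylinders shorter than 1/(2n)^2; two
   distinct fractions with denominators in (n, 2n] never share a cylinder,
   and choosing numerators in a bounded window that are almost coprime to the
   denominator produces more fractions than there are cylinders. *)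

(** * Sup norm, compactness and surjectivity of similarities *)

Lemma ler_coord_norm (R : realType) (d : nat) (x : 'rV[R]_d) (i : 'I_d) :
  `|x 0 i| <= `|x|.
Proof.
rewrite [leRHS]/Num.Def.normr /= mx_normrE.
by rewrite (le_trans _ (le_bigmax _ _ (0, i))).
Qed.

Lemma ler_norm_coord (R : realType) (d : nat) (x : 'rV[R]_d) (c : R) :
  0 <= c -> (forall i, `|x 0 i| <= c) -> `|x| <= c.
Proof.
move=> c0 xc; rewrite [leLHS]/Num.Def.normr /= mx_normrE.
by apply: bigmax_le => // -[i j] _ /=; rewrite ord1.
Qed.

Lemma ltr_norm_coord (R : realType) (d : nat) (x : 'rV[R]_d) (c : R) :
  0 < c -> (forall i, `|x 0 i| < c) -> `|x| < c.
Proof.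
move=> c0 xc; rewrite [ltLHS]/Num.Def.normr /= mx_normrE.
by apply: bigmax_lt => // -[i j] _ /=; rewrite ord1.
Qed.

Lemma norm_attained (R : realType) (d : nat) (x : 'rV[R]_d) :
  0 < `|x| -> exists i, `|x 0 i| = `|x|.
Proof.
move=> x0; have [//|nex] := pselect (exists i, `|x 0 i| = `|x|).
suff : `|x| < `|x| by rewrite ltxx.
apply: ltr_norm_coord => // i; rewrite lt_neqAle ler_coord_norm andbT.
by apply/eqP => e; apply: nex; exists i.
Qed.

Lemma compact_limit_point (R : realType) (V : normedModType R) (K : set V)
    (u : nat -> V) : compact K -> (forall n, K (u n)) ->
  exists2 a, K a &
    forall (e : R) (N : nat), 0 < e -> exists2 n, (N <= n)%N & `|u n - a| < e.
Proof.
move=> cK uK; have [|a [Ka ca]] := cK (u @ \oo) _.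
  by exists 0%N => // n _; exact: uK.
exists a => // e N e0.
have [|_ [[n Nn <-] una]] := ca [set u n | n in [set n | (N <= n)%N]] (ball a e) _
  (nbhsx_ballx a e e0).
  by exists N => // n /= Nn; exists n.
by exists n => //; move: una; rewrite -ball_normE /= distrC.
Qed.

Lemma closed_approx (R : realType) (V : normedModType R) (A : set V) (x : V) :
  closed A -> (forall e : R, 0 < e -> exists2 y, A y & `|x - y| < e) -> A x.
Proof.
move=> cA H; apply: cA => B /nbhs_ballP [e /= e0 eB].
have [y Ay xy] := H e e0; exists y; split => //; apply: eB.
by rewrite -ball_normE.
Qed.

Lemma compact_norm_le (R : realType) (V : normedModType R) (A : set V) :
  compact A -> exists2 B : R, 0 < B & forall x, A x -> `|x| <= B.
Proof.
move=> /compact_bounded [M [_ HM]]; exists (`|M| + 1); first by rewrite ltr_wpDl.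
by apply: HM; rewrite (le_lt_trans (ler_norm M))// ltrDl.
Qed.

Lemma compact_norm_ball (R : realType) (d : nat) (B : R) :
  compact [set x : 'rV[R]_d | `|x| <= B].
Proof.
apply: bounded_closed_compact.
  exists B; split => [|M BM x /= xB]; first exact: num_real.
  exact: le_trans xB (ltW BM).
have -> : [set x : 'rV[R]_d | `|x| <= B] = closed_ball_ Num.Def.normr 0 B.
  by apply/funext => x; rewrite /closed_ball_ /= sub0r normrN.
exact: closed_closed_ball_.
Qed.

Definition similarity (R : realType) (d : nat) (t : R)
    (f : 'rV[R]_d -> 'rV[R]_d) : Prop :=
  0 < t /\ forall x y, `|f x - f y| = t * `|x - y|.

Lemma similarity_inj (R : realType) (d : nat) (t : R)
  (f : 'rV[R]_d -> 'rV[R]_d) : similarity t f -> injective f.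
Proof.
move=> [t0 tf] x y fxy; apply/eqP; rewrite -subr_eq0 -normr_eq0.
have := tf x y; rewrite fxy subrr normr0 => /esym/eqP.
by rewrite mulf_eq0 (gt_eqF t0).
Qed.

(** By compactness two iterates of [y] come arbitrarily close; cancelling their common steps shows
    that [y] is a limit of values of [g] on the ball of radius [|y|]. Compactness of that ball then
    makes [y] itself a value. *)
Lemma isometry_surjective (R : realType) (d : nat) (g : 'rV[R]_d -> 'rV[R]_d) :
  g 0 = 0 -> (forall x y, `|g x - g y| = `|x - y|) ->
  forall y, exists x, g x = y.
Proof.
move=> g0 gi y.
have gn x : `|g x| = `|x| by have := gi x 0; rewrite g0 !subr0.
have iK n : `|iter n g y| <= `|y| by elim: n => //= n; rewrite gn.
have im e : 0 < e -> exists2 x, `|x| <= `|y| & `|y - g x| < e.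
  move=> e0.
  have [a _ ca] := compact_limit_point (compact_norm_ball (B := `|y|)) iK.
  have e20 : 0 < e / 2 by rewrite divr_gt0.
  have [m _ ma] := ca _ 0%N e20; have [n mn na] := ca _ m.+1 e20.
  exists (iter (n - m).-1 g y) => //.
  rewrite -iterS prednK ?subn_gt0//.
  have shift k x z : `|iter k g x - iter k g z| = `|x - z|.
    by elim: k => //= k <-; rewrite gi.
  rewrite -(shift m) -iterD subnKC; last exact: ltnW.
  rewrite (_ : _ - _ = (iter m g y - a) - (iter n g y - a)); last first.
    by rewrite opprB addrA subrK.
  by rewrite (le_lt_trans (ler_normB _ _))// (splitr e) ltrD.
have e0 n : 0 < (n.+1%:R^-1 : R) by [].
pose x n := projT1 (cid2 (im _ (e0 n))).
have [xy xg] : (forall n, `|x n| <= `|y|) /\ forall n, `|y - g (x n)| < n.+1%:R^-1.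
  by split=> n; rewrite /x; case: cid2.
have [a _ ca] := compact_limit_point (compact_norm_ball (B := `|y|)) xy.
exists a; apply/eqP; rewrite -subr_eq0 -normr_le0; apply/ler_addgt0Pl => e e_gt0.
have e20 : 0 < e / 2 by rewrite divr_gt0.
have [n Nn na] := ca _ (Num.bound (2 / e)) e20.
rewrite addr0 (_ : _ - _ = (g a - g (x n)) - (y - g (x n))); last first.
  by rewrite opprB addrA subrK.
rewrite (le_trans (ler_normB _ _))// (splitr e) lerD//.
  by rewrite gi distrC ltW.
apply: (le_trans (ltW (xg n))).
rewrite -[leRHS]invrK lef_pV2 ?posrE ?invr_gt0// invf_div.
have /ltW/le_trans -> // := archi_boundP (ltW (divr_gt0 (ltr0Sn R 1) e_gt0)).
by rewrite ler_nat ltnW.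
Qed.

Lemma similarity_surjective (R : realType) (d : nat) (t : R)
    (f : 'rV[R]_d -> 'rV[R]_d) : similarity t f -> forall y, exists x, f x = y.
Proof.
move=> [t0 tf] y; pose g x := t^-1 *: (f x - f 0).
have [| |x gx] := @isometry_surjective _ _ g _ _ (t^-1 *: (y - f 0)).
- by rewrite /g subrr scaler0.
- move=> a b; rewrite /g -scalerBr normrZ opprB addrA subrK tf.
  by rewrite gtr0_norm ?invr_gt0// mulKf ?gt_eqF.
exists x; move: gx; rewrite /g => /scalerI; rewrite invr_eq0 gt_eqF// => /(_ isT).
by move/(congr1 (+%R^~ (f 0))); rewrite !subrK.
Qed.

(** * Similarities are affine *)

Lemma halfD (R : realType) (V : lmodType R) (x : V) : 2^-1 *: (x + x) = x.
Proof.
by rewrite scalerDr -scalerDl (_ : _ + _ = 1) ?scale1r//; field.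
Qed.

(* Väisälä's form of the Mazur–Ulam argument: conjugating by the reflection at
   the midpoint doubles the displacement of the midpoint. *)
Lemma isometry_fix_midpoint (R : realType) (V : normedModType R) (a b : V)
    (g h : V -> V) :
  (forall x y, `|g x - g y| = `|x - y|) -> cancel g h -> cancel h g ->
  g a = a -> g b = b -> g (2^-1 *: (a + b)) = 2^-1 *: (a + b).
Proof.
set z := 2^-1 *: (a + b); move=> gi gh hg ga gb.
have zz : z + z = a + b by rewrite -mulr2n -scaler_nat scalerA divff// scale1r.
suff H n : 2 ^+ n * `|g z - z| <= 2 * `|a - z|.
  have [gz0|gz0] := leP `|g z - z| 0.
    by apply/eqP; rewrite -subr_eq0 -normr_le0.
  have := upper_nthrootP (leqnn (Num.bound (2 * `|a - z| / `|g z - z|))).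
  by rewrite ltr_pdivrMr// ltNge H.
(* The induction generalizes over all bijective isometries fixing [a] and [b], because the step
   replaces [g] by [psi \o h \o psi \o g]. *)
elim: n g h gi gh hg ga gb => [|n IH] g h gi gh hg ga gb.
  rewrite expr0 mul1r (_ : g z - z = (g z - a) + (a - z));
    last by rewrite addrA subrK.
  rewrite (le_trans (ler_normD _ _))// mulr_natl mulr2n lerD2r.
  by rewrite -[in leLHS]ga gi distrC.
pose psi x := a + b - x.
have psiK : involutive psi by move=> x; rewrite /psi opprB addrC subrK.
have psii x y : `|psi x - psi y| = `|x - y|.
  by rewrite /psi opprB addrC subrKA distrC.
have psiz : psi z = z by rewrite /psi -zz addrK.
have psia : psi a = b by rewrite /psi addrC addKr.
have psib : psi b = a by rewrite /psi addrK.
have hi x y : `|h x - h y| = `|x - y| by rewrite -gi !hg.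
have hb : h b = b by rewrite -{1}gb gh.
have ha : h a = a by rewrite -{1}ga gh.
rewrite exprSr -mulrA (le_trans _ (IH (psi \o h \o psi \o g) (h \o psi \o g \o psi)
  _ _ _ _ _))//=.
- rewrite ler_pM2l ?exprn_gt0// -[X in _ <= `|_ - X|]psiz psii
    -[X in _ <= `|_ - X|]gh hi.
  rewrite /psi -zz.
  have -> : z + z - g z - g z = - (2 *: (g z - z)).
    by rewrite scaler_nat mulr2n opprD opprB -addrA addrACA.
  by rewrite normrN normrZ ger0_norm.
- by move=> x y; rewrite psii hi psii gi.
- by move=> x /=; rewrite psiK hg psiK gh.
- by move=> x /=; rewrite hg psiK gh psiK.
- by rewrite ga psia hb psib.
- by rewrite gb psib ha psia.
Qed.

(** With [psi] and [phi] the reflections at the two midpoints, [psi \o h \o phi \o f] is an isometry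
    fixing [a] and [b], hence their midpoint [z]. So [f z] is fixed by [phi], whose only fixed point
    is the midpoint of [f a] and [f b]. *)
Lemma similarity_midpoint (R : realType) (d : nat) (t : R)
    (f : 'rV[R]_d -> 'rV[R]_d) : similarity t f ->
  forall a b, f (2^-1 *: (a + b)) = 2^-1 *: (f a + f b).
Proof.
move=> simf a b; have [t0 tf] := simf.
have /choice[h fh] := similarity_surjective simf.
have hf x : h (f x) = x by apply: (similarity_inj simf); rewrite fh.
have th x y : `|h x - h y| = t^-1 * `|x - y|.
  by rewrite -{2}(fh x) -{2}(fh y) tf mulKf ?gt_eqF.
set z := 2^-1 *: (a + b); set w := 2^-1 *: (f a + f b).
have half (u v : 'rV[R]_d) : u + v - 2^-1 *: (u + v) = 2^-1 *: (u + v).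
  by rewrite -{1}[u + v]scale1r -scalerBl; congr (_ *: _); field.
pose psi x := a + b - x; pose phi x := f a + f b - x.
have psiK x : psi (psi x) = x by rewrite /psi opprB addrC subrK.
have phiK x : phi (phi x) = x by rewrite /phi opprB addrC subrK.
have psii x y : `|psi x - psi y| = `|x - y|.
  by rewrite /psi opprB addrC subrKA distrC.
have phii x y : `|phi x - phi y| = `|x - y|.
  by rewrite /phi opprB addrC subrKA distrC.
have : (psi \o h \o phi \o f) z = z.
  apply: (@isometry_fix_midpoint _ _ _ _ _ (h \o phi \o f \o psi)) => /=.
  - by move=> x y; rewrite psii th phii tf mulKf ?gt_eqF.
  - by move=> x /=; rewrite psiK fh phiK hf.
  - by move=> x /=; rewrite fh phiK hf psiK.
  - by rewrite /phi addrC addKr hf /psi addrK.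
  - by rewrite /phi addrK hf /psi addrC addKr.
move=> /(congr1 psi) /=; rewrite psiK /psi half => /(congr1 f).
rewrite fh /phi -/z => /eqP; rewrite subr_eq => /eqP fz.
by rewrite /w fz halfD.
Qed.

(** Preserving midpoints makes [g = f - f 0] additive, hence homogeneous over the integers; the norm
    identity extends this to real scalars. *)
Lemma similarity_affine (R : realType) (d : nat) (t : R)
    (f : 'rV[R]_d -> 'rV[R]_d) : similarity t f ->
  exists A : 'M[R]_d, forall x, f x = f 0 + x *m A.
Proof.
move=> simf; have [t0 tf] := simf; pose g x := f x - f 0.
have fmid := similarity_midpoint simf.
have gi x y : `|g x - g y| = t * `|x - y| by rewrite /g opprB addrA subrK tf.
have g0 : g 0 = 0 by rewrite /g subrr.
have g2 x : 2^-1 *: g (x + x) = g x.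
  have := fmid (x + x) 0.
  rewrite addr0 halfD /g => ->.
  by rewrite -[X in _ = _ - X]halfD -scalerBr opprD addrA addrK.
have gD x y : g (x + y) = g x + g y.
  rewrite -[g x]g2 -[g y]g2 -scalerDr.
  have := fmid (x + x) (y + y).
  rewrite addrACA halfD /g => ->.
  by rewrite -[X in _ - X = _]halfD -scalerBr opprD addrACA.
have gN x : g (- x) = - g x by apply/eqP; rewrite -addr_eq0 -gD addrC subrr g0.
have gn x n : g (n%:R *: x) = n%:R *: g x.
  elim: n => [|n IH]; first by rewrite !scale0r g0.
  by rewrite -natr1 !scalerDl gD IH !scale1r.
have gz x (m : int) : g (m%:~R *: x) = m%:~R *: g x.
  by case: m => n; rewrite ?NegzE ?mulrNz ?scaleNr ?gN ?gn.
have gnorm x : `|g x| = t * `|x| by have := gi x 0; rewrite g0 !subr0.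
have gZ (s : R) x : g (s *: x) = s *: g x.
  apply/eqP; rewrite -subr_eq0 -normr_le0 leNgt; apply/negP.
  set e := `|_| => e0.
  (* Multiplying the defect [e] by [n] and removing the integer part of [n * s] leaves the defect at
     a scalar in [0, 1], at most [2 * t * |x|]; this [n] is too large for that. *)
  pose n := Num.bound (2 * (t * `|x|) / e).
  have : 2 * (t * `|x|) / e < n%:R.
    by apply: archi_boundP; rewrite divr_ge0 ?(ltW e0)// !mulr_ge0// ltW.
  rewrite ltr_pdivrMr// ltNge => /negP; apply.
  pose k := Num.floor (n%:R * s).
  have -> : n%:R * e = `|g ((n%:R * s - k%:~R) *: x) - (n%:R * s - k%:~R) *: g x|.
    rewrite scalerBl gD gN gz -scalerA gn scalerBl -scalerA opprB addrA subrK
      -scalerBr normrZ ger0_norm//.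
  have /andP[k0 k1] : 0 <= n%:R * s - k%:~R <= 1.
    have /andP[kl kr] := floor_itv (n%:R * s).
    by rewrite subr_ge0 kl lerBlDl; rewrite intrD in kr; exact: ltW.
  rewrite (le_trans (ler_normB _ _))// gnorm !normrZ gnorm ger0_norm//.
  have : (n%:R * s - k%:~R) * (t * `|x|) <= t * `|x|.
    by rewrite ler_piMl// mulr_ge0// ltW.
  lra.
have lg : linear g by move=> s x y; rewrite gD gZ.
pose gL := GRing.isLinear.Build _ _ _ _ g lg.
pose G : {linear 'rV[R]_d -> 'rV[R]_d} := HB.pack g gL.
exists (lin1_mx G) => x; rewrite mul_rV_lin1 /= /g addrC subrK //.
Qed.

(** * Rational vectors *)

Lemma similarity_mx_norm (R : realType) (d : nat) (t : R)
    (f : 'rV[R]_d -> 'rV[R]_d) (A : 'M[R]_d) :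
  similarity t f -> (forall x, f x = f 0 + x *m A) ->
  forall x : 'rV_d, `|x *m A| = t * `|x|.
Proof.
by move=> [_ tf] fA x; rewrite -[in RHS](subr0 x) -tf (fA x) addrAC subrr add0r.
Qed.

Lemma norm_delta_row (R : realType) (d : nat) (i : 'I_d) :
  `|delta_mx 0 i : 'rV[R]_d| = 1.
Proof.
apply/eqP; rewrite eq_le; apply/andP; split.
  by apply: ler_norm_coord => // j; rewrite mxE eqxx /=; case: eqP;
    rewrite ?normr1 ?normr0.
by have := ler_coord_norm (delta_mx 0 i : 'rV[R]_d) i; rewrite mxE !eqxx normr1.
Qed.

(** The image of the i-th unit vector attains its norm [t] at some coordinate [j]. Testing [A] on
    the signs of column [j] bounds the absolute sum of that column by [t], so all its other entries
    vanish. *)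
Lemma sup_norm_isometry_coord (R : realType) (d : nat) (t : R) (A : 'M[R]_d) :
  0 < t -> (forall x : 'rV_d, `|x *m A| = t * `|x|) ->
  forall i, exists (j : 'I_d) (s : bool),
    forall x : 'rV_d, (x *m A) 0 j = (-1) ^+ s * t * x 0 i.
Proof.
move=> t0 tA i.
have di : `|(delta_mx 0 i : 'rV_d) *m A| = t by rewrite tA norm_delta_row mulr1.
have [j dj] : exists j, `|A i j| = t.
  have [|j] := norm_attained (_ : 0 < `|(delta_mx 0 i : 'rV_d) *m A|);
    first by rewrite di.
  by rewrite di -rowE mxE => Aij; exists j.
have sum_le : \sum_k `|A k j| <= t.
  pose x := \row_k Num.sg (A k j).
  have x1 : `|x| <= 1.
    by apply: ler_norm_coord => // k; rewrite mxE normr_sg lern1 leq_b1.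
  have -> : \sum_k `|A k j| = (x *m A) 0 j.
    by rewrite mxE; apply: eq_bigr => k _; rewrite mxE normrEsg.
  apply: le_trans (ler_norm _) (le_trans (ler_coord_norm (x *m A) j) _).
  by rewrite tA ler_piMr// ltW.
have A0 k : k != i -> A k j = 0.
  move=> ki; apply/eqP; rewrite -normr_le0.
  move: sum_le; rewrite (bigD1 i)//= dj gerDl (bigD1 k)//=; apply: le_trans.
  by rewrite lerDl sumr_ge0.
exists j, (A i j < 0) => x; rewrite mxE (bigD1 i)//= big1 ?addr0 => [|k ki];
  last first.
  by rewrite A0// mulr0.
by rewrite mulrC -dj; congr (_ * _); apply: realEsign; exact: num_real.
Qed.

Lemma rational_vectors_ratvec (R : realType) (d : nat) (p : 'rV[int]_d) (q : nat) :
  rational_vectors R d (ratvec R p q).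
Proof.
exists (q%:R^-1 *: map_mx intr p) => //.
by apply/rowP => i; rewrite !mxE rmorphM /= fmorphV rmorph_nat rmorph_int.
Qed.

Lemma rational_vectorsP (R : realType) (d : nat) (x : 'rV[R]_d) :
  rational_vectors R d x -> exists (p : 'rV[int]_d) (q : nat),
    (0 < q)%N /\ x = ratvec R p q.
Proof.
move=> [y _ <-].
exists (\row_i (numq (y 0 i) * \prod_(k | k != i) denq (y 0 k))).
exists (\prod_(k < d) `|denq (y ord0 k)|)%N; split.
  by rewrite prodn_gt0// => k; rewrite absz_gt0 denq_neq0.
apply/rowP => i; rewrite !mxE.
have absden (k : 'I_d) : (`|denq (y ord0 k)|%N)%:R = (denq (y 0 k))%:~R :> R.
  by rewrite -[in RHS](gez0_abs (denq_ge0 _)).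
rewrite (bigD1 i)//= natrM intrM absden.
have -> : ((\prod_(k < d | k != i) `|denq (y ord0 k)|)%N%:R : R) =
    (\prod_(k | k != i) denq (y 0 k))%:~R.
  by rewrite natr_prod rmorph_prod /=; apply: eq_bigr => k _; rewrite absden.
have P0 : (\prod_(k | k != i) denq (y 0 k))%:~R != 0 :> R.
  by rewrite intr_eq0; apply/prodf_neq0 => k _; rewrite denq_neq0.
have D0 : (denq (y 0 i))%:~R != 0 :> R by rewrite intr_eq0 denq_neq0.
rewrite /ratr; field; exact/andP.
Qed.

(** The translation and the linear part [B] of [f] are rational. Since [v = v *m B] would give
    [|v| = t * |v|], the matrix [1 - B] is invertible over the rationals, and the fixed point
    equation is solved there. *)
Lemma rational_fixed_point (R : realType) (d : nat) (t : R)
    (f : 'rV[R]_d -> 'rV[R]_d) : similarity t f -> t < 1 ->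
  f @` rational_vectors R d `<=` rational_vectors R d ->
  exists2 x, rational_vectors R d x & f x = x.
Proof.
move=> simf t1 fQ; have [A fA] := similarity_affine simf.
have tA := similarity_mx_norm simf fA.
have ratf (x : 'rV[rat]_d) : exists y : 'rV[rat]_d, map_mx ratr y = f (map_mx ratr x).
  by have [|y _ ye] := fQ (f (map_mx ratr x)); [exists (map_mx ratr x) => //;
    exists x | exists y].
have [b fb] := ratf 0; rewrite map_mx0 in fb.
have /choice[B0 fB] := fun i => ratf (delta_mx 0 i).
pose B := \matrix_i (B0 i - b).
have AB : A = map_mx ratr B.
  apply/row_matrixP => i; rewrite -map_row rowK map_mxB fB fb fA map_delta_mx.
  by rewrite addrAC subrr add0r rowE.
have B1 : 1%:M - B \in unitmx.
  rewrite unitmxE unitfE; apply/det0P => -[v v0].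
  rewrite mulmxBr mulmx1 => /eqP; rewrite subr_eq0 => /eqP vB.
  have := tA (map_mx ratr v); rewrite AB -map_mxM -vB => /eqP.
  rewrite -subr_eq0 -{1}[`|_|]mul1r -mulrBl mulf_eq0 subr_eq0 (gt_eqF t1) /=.
  by rewrite normr_eq0 map_mx_eq0 (negbTE v0).
pose x := b *m invmx (1%:M - B).
have xB : x = b + x *m B.
  by rewrite -[in RHS](mulmxKV B1 b) -/x mulmxBr mulmx1 subrK.
exists (map_mx ratr x); first by exists x.
by rewrite fA -fb AB -map_mxM -map_mxD -xB.
Qed.

Lemma expr_lt_eps (R : realType) (t B e : R) : 0 <= t < 1 -> 0 <= B -> 0 < e ->
  exists n, t ^+ n * B < e.
Proof.
move=> /andP[t0 t1] B0 e0.
have t1' : `|t| < 1 by rewrite ger0_norm.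
have := cvg_geometric B t1' => /cvgrPdist_lt/(_ e e0)[n _ /(_ n (leqnn n))].
rewrite sub0r normrN /= => H; exists n; rewrite mulrC (le_lt_trans (ler_norm _))//.
Qed.

(** * Attractors *)

Section Attractor.
Variables (R : realType) (d J : nat) (f : 'I_J -> 'rV[R]_d -> 'rV[R]_d).
Variables (tau : 'I_J -> R) (C : set 'rV[R]_d).
Hypothesis hf : forall j, contracting_similarity (tau j) (f j).
Hypothesis hC : is_attractor f C.

Let ratio (w : seq 'I_J) : R := \prod_(j <- w) tau j.

Lemma tau_gt0 j : 0 < tau j. Proof. by have [/andP[]] := hf j. Qed.

Lemma tau_lt1 j : tau j < 1. Proof. by have [/andP[]] := hf j. Qed.

Lemma map_similarity j : similarity (tau j) (f j).
Proof. by split; [exact: tau_gt0 | have [] := hf j]. Qed.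

Lemma ratio_gt0 w : 0 < ratio w.
Proof. by apply: prodr_gt0 => j _; exact: tau_gt0. Qed.

Lemma word_similarity w : similarity (ratio w) (fun x => foldr f x w).
Proof.
split=> [|x y]; first exact: ratio_gt0.
rewrite /ratio; elim: w => [|j w IH] /=; first by rewrite big_nil mul1r.
by rewrite big_cons -mulrA -IH; have [_ ->] := hf j.
Qed.

Lemma word_attractor w x : C x -> C (foldr f x w).
Proof.
move=> Cx; elim: w => //= j w Cw; have [_ _ <-] := hC.
by exists j => //; exists (foldr f x w).
Qed.

Lemma attractor_map x : C x -> exists j y, C y /\ x = f j y.
Proof. by have [_ _ {1}<-] := hC => -[j _ [y Cy <-]]; exists j, y. Qed.

Lemma attractor_word n x : C x ->
  exists w y, [/\ size w = n, C y & x = foldr f y w].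
Proof.
elim: n x => [|n IH] x Cx; first by exists [::], x.
have [j [y [Cy ->]]] := attractor_map Cx; have [w [z [wn Cz ->]]] := IH y Cy.
by exists (j :: w), z; rewrite /= wn.
Qed.

Lemma ratio_le_expr (t : R) w : (forall j, tau j <= t) -> ratio w <= t ^+ size w.
Proof.
move=> tt; rewrite /ratio; elim: w => [|j w IH]; first by rewrite big_nil.
rewrite big_cons /= exprS ler_pM// ltW ?tau_gt0//; exact: ratio_gt0.
Qed.

Lemma tau_le_max : exists t : R, 0 <= t < 1 /\ forall j, tau j <= t.
Proof.
exists (\big[Num.max/0]_(j < J) tau j); split => [|j]; last exact: le_bigmax.
apply/andP; split; first exact: bigmax_ge_id.
by apply: bigmax_lt => // j _; exact: tau_lt1.
Qed.

Lemma attractor_closed : closed C.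
Proof. by have [_ cC _] := hC; exact: compact_closed. Qed.

Lemma attractor_norm_le : exists2 B : R, 0 < B & forall x, C x -> `|x| <= B.
Proof. by have [_ cC _] := hC; exact: compact_norm_le. Qed.

Lemma fixed_word x w : (forall j, j \in w -> f j x = x) -> foldr f x w = x.
Proof.
elim: w => //= j w IH H; rewrite IH ?H ?mem_head// => i iw.
by rewrite H// in_cons iw orbT.
Qed.

(** Iterating [f j] from any point of the closed set [C] converges to [x]. *)
Lemma fixed_point_attractor j x : f j x = x -> C x.
Proof.
move=> fx; apply: (closed_approx attractor_closed) => e e0.
have [[c Cc] _ _] := hC; have [t [t01 tt]] := tau_le_max.
have [n tn] := expr_lt_eps t01 (normr_ge0 (x - c)) e0.
exists (foldr f c (nseq n j)); first exact: word_attractor.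
rewrite -{1}(@fixed_word x (nseq n j)); last by move=> i /nseqP[->].
have [_ ->] := word_similarity (nseq n j); apply: le_lt_trans tn.
by rewrite ler_wpM2r// -[X in _ ^+ X](size_nseq n j) ratio_le_expr.
Qed.

Lemma cylinder_diam t B w x y :
  (forall j, tau j <= t) -> (forall x, C x -> `|x| <= B) ->
  C x -> C y -> `|foldr f x w - foldr f y w| <= t ^+ size w * (2 * B).
Proof.
move=> tt CB Cx Cy; have [_ ->] := word_similarity w.
rewrite ler_pM ?ratio_le_expr ?(ltW (ratio_gt0 _))// (le_trans (ler_normB _ _))//.
by rewrite mulr_natl mulr2n lerD// CB.
Qed.

Hypothesis hrat : forall j, f j @` rational_vectors R d `<=` rational_vectors R d.

Lemma word_rational w x :
  rational_vectors R d x -> rational_vectors R d (foldr f x w).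
Proof. by move=> Qx; elim: w => //= j w IH; apply: (hrat (j := j));
  exists (foldr f x w). Qed.

Hypothesis hC2 : exists x y : 'rV[R]_d, [/\ C x, C y & x != y].

(** Some map has a rational fixed point [x1] in [C]. If another map moves it, the image is a second
    point; if all maps fix it, every small cylinder lies close to [x1] and [C] reduces to [x1]. *)
Lemma two_rational_points : exists x1 x2, [/\ (rational_vectors R d `&` C) x1,
  (rational_vectors R d `&` C) x2 & x1 != x2].
Proof.
have [[c Cc] _ _] := hC; have [j0 _] := attractor_map Cc.
have [x1 Qx1 fx1] := rational_fixed_point (map_similarity j0) (tau_lt1 j0)
  (hrat (j := j0)).
have Cx1 := fixed_point_attractor fx1.
have [[j fj]|nfj] := pselect (exists j, f j x1 != x1).
  exists x1, (f j x1); split => //; last by rewrite eq_sym.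
  by split; [exact: (word_rational [:: j]) | exact: (word_attractor [:: j])].
have fall j : f j x1 = x1 by apply/eqP/negP => /negP H; apply: nfj; exists j.
have [t [t01 tt]] := tau_le_max; have [B B0 CB] := attractor_norm_le.
have eq1 x : C x -> x = x1.
  move=> Cx; apply/eqP; rewrite -subr_eq0 -normr_le0; apply/ler_addgt0Pl => e e0.
  have [n tn] := expr_lt_eps t01 (mulr_ge0 (ler0n R 2) (ltW B0)) e0.
  have [w [y [wn Cy ->]]] := attractor_word n Cx.
  rewrite addr0 -{1}(@fixed_word x1 w)//.
  by rewrite (le_trans (cylinder_diam w tt CB Cy Cx1))// wn ltW.
by have [x [y [/eq1 -> /eq1 ->]]] := hC2; rewrite eqxx.
Qed.

(** A small cylinder around [x] contains the images of two rational points under one injective map,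
    and at most one image equals [z]. *)
Lemma rational_points_perfect x r : C x -> 0 < r ->
  forall z, exists y, [/\ (rational_vectors R d `&` C) y, y != z & `|y - x| < r].
Proof.
move=> Cx r0 z.
have [x1 [x2 [[Qx1 Cx1] [Qx2 Cx2] x12]]] := two_rational_points.
have [t [t01 tt]] := tau_le_max; have [B B0 CB] := attractor_norm_le.
have [n tn] := expr_lt_eps t01 (mulr_ge0 (ler0n R 2) (ltW B0)) r0.
have [w [y [wn Cy ->]]] := attractor_word n Cx.
have near u : C u -> `|foldr f u w - foldr f y w| < r.
  by move=> Cu; rewrite (le_lt_trans (cylinder_diam w tt CB Cu Cy))// wn.
have [e1|ne1] := eqVneq (foldr f x1 w) z.
  exists (foldr f x2 w); split; [|rewrite -e1|exact: near].
    by split; [exact: word_rational | exact: word_attractor].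
  by apply: contra x12 => /eqP/(similarity_inj (word_similarity w)) ->.
exists (foldr f x1 w); split => //; last exact: near.
by split; [exact: word_rational | exact: word_attractor].
Qed.

(** Nested balls centred at rational points of [C], the n-th of which misses the n-th rational
    vector; the radius is chosen after the denominator [b] of the centre is known. *)
Lemma exists_fast_intrinsic_approx (Psi : nat -> nat -> R) :
  (forall n b, (0 < b)%N -> 0 < Psi n b) ->
  exists xi, (C `\` rational_vectors R d) xi /\
    forall n, exists (p : 'rV[int]_d) (b : nat),
      [/\ (0 < b)%N, C (ratvec R p b) & `|xi - ratvec R p b| < Psi n b].
Proof.
move=> Psi0.
(* An enumeration of the rational vectors; the default 0 at codes of nothing is harmless, as only
   surjectivity matters. *)
pose z n : 'rV[R]_d := map_mx ratr (odflt (0 : 'rV[rat]_d) (unpickle n)).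
pose Inv (s : 'rV[R]_d * R) := C s.1 /\ 0 < s.2.
(* A state is a centre and a radius. The clauses say that the new closed ball lies in the old one,
   misses [z n], and has a radius below the bound for its centre. *)
pose step n (s s' : 'rV[R]_d * R) := [/\ Inv s', `|s'.1 - s.1| + s'.2 <= s.2,
  s'.2 < `|z n - s'.1| &
  exists (p : 'rV[int]_d) (b : nat), [/\ (0 < b)%N,
    s'.1 = ratvec R p b & s'.2 < Psi n b]].
have next (ns : nat * ('rV[R]_d * R)) : exists s', Inv ns.2 -> step ns.1 ns.2 s'.
  case: ns => n [x r] /=.
  have [[/= Cx r0]|nI] := pselect (Inv (x, r)); last by exists (x, r).
  have r20 : 0 < r / 2 by rewrite divr_gt0.
  have [y [[Qy Cy] yz yx]] := rational_points_perfect Cx r20 (z n).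
  have [p [b [b0 yE]]] := rational_vectorsP Qy.
  have zy0 : 0 < `|z n - y| by rewrite normr_gt0 subr_eq0 eq_sym.
  pose m := Num.min (r / 2) (Num.min `|z n - y| (Psi n b)).
  have m0 : 0 < m by rewrite !lt_min r20 zy0 Psi0.
  have m20 : m / 2 < m by rewrite gtr_pMr// invf_lt1// ltr1n.
  have [mr mz mp] : [/\ m <= r / 2, m <= `|z n - y| & m <= Psi n b].
    by rewrite /m !ge_min !lexx ?orbT.
  exists (y, m / 2) => _; split => /=.
  - by split => //=; rewrite divr_gt0.
  - by rewrite [leRHS]splitr lerD// ltW// (lt_le_trans m20).
  - exact: lt_le_trans mz.
  - by exists p, b; split => //; exact: lt_le_trans mp.
have /choice[g gP] := next.
have [[c Cc] cC _] := hC.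
pose s := fix s n := if n is k.+1 then g (k, s k) else (c, 1).
have sI n : Inv (s n).
  by elim: n => [|n IH] /=; [split => /= | have [] := gP (n, s n) IH].
have sS n : step n (s n) (s n.+1).
  exact: gP (n, s n) (sI n).
have sD n k : `|(s (n + k)%N).1 - (s n).1| + (s (n + k)%N).2 <= (s n).2.
  elim: k => [|k IH]; first by rewrite addn0 subrr normr0 add0r.
  rewrite addnS; have [_ H _ _] := sS (n + k)%N; apply: le_trans IH.
  rewrite (le_trans _ (lerD (lexx _) H))// addrA lerD2r -[X in _ <= X]addrC.
  by rewrite -[X in `|X|](subrKA (s (n + k)%N).1) ler_normD.
have [a Ca ca] := compact_limit_point cC (fun n => (sI n).1).
have aD n : `|a - (s n).1| <= (s n).2.
  apply/ler_addgt0Pl => e e0; have [k nk ak] := ca e n e0.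
  rewrite -(subrKA (s k).1) (le_trans (ler_normD _ _))// lerD//.
    by rewrite distrC ltW.
  by rewrite (le_trans _ (sD n (k - n)%N))// subnKC// lerDl ltW// (sI k).2.
exists a; split; [split => //|move=> n].
  move=> [x _ xa]; have [_ _ + _] := sS (pickle x).
  by rewrite /z pickleK [odflt _ _]/= xa ltNge aD.
have [_ _ _ [p [b [b0 E H]]]] := sS n.
exists p, b; split => //; rewrite -E; first exact: (sI n.+1).1.
exact: le_lt_trans (aD n.+1) H.
Qed.

End Attractor.

(** * Intrinsic approximation *)

Lemma ratr_dist_ge (R : realType) (a b : int) (p q : nat) : (0 < p)%N -> (0 < q)%N ->
  p%:R^-1 * a%:~R != q%:R^-1 * b%:~R :> R ->
  (p%:R * q%:R)^-1 <= `|p%:R^-1 * a%:~R - q%:R^-1 * b%:~R| :> R.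
Proof.
move=> p0 q0; have p0R : 0 < p%:R :> R by rewrite ltr0n.
have q0R : 0 < q%:R :> R by rewrite ltr0n.
have E : p%:R^-1 * a%:~R - q%:R^-1 * b%:~R =
    (p%:R * q%:R)^-1 * (a * q%:Z - b * p%:Z)%:~R :> R.
  by rewrite intrD mulrNz !intrM -!pmulrn; field; rewrite !gt_eqF.
rewrite -subr_eq0 E normrM ger0_norm ?invr_ge0 ?mulr_ge0// mulf_eq0 negb_or.
move=> /andP[_]; rewrite intr_eq0 => n0.
by rewrite ler_peMr ?invr_ge0 ?mulr_ge0// -intr_norm -[1]/(1%:~R) ler_int -gtz0_ge1
  normr_gt0.
Qed.

Lemma ratvec_dist_ge (R : realType) (d : nat) (a b : 'rV[int]_d) (p q : nat) :
  (0 < p)%N -> (0 < q)%N -> ratvec R a p != ratvec R b q ->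
  (p%:R * q%:R)^-1 <= `|ratvec R a p - ratvec R b q|.
Proof.
move=> p0 q0 ne.
have [i] : exists i, ratvec R a p 0 i != ratvec R b q 0 i.
  apply/existsP; apply: contraNT ne => /existsPn H.
  by apply/eqP/rowP => i; have := H i; rewrite negbK => /eqP.
rewrite !mxE => /(ratr_dist_ge p0 q0)/le_trans; apply.
by apply: le_trans (ler_coord_norm _ i); rewrite !mxE.
Qed.

(** A finite set is closed, so it contains every point that it approaches. *)
Lemma infinite_approached (R : realType) (d : nat) (S : set 'rV[R]_d) (x : 'rV[R]_d) :
  ~ S x -> (forall e : R, 0 < e -> exists2 y, S y & `|x - y| < e) -> infinite_set S.
Proof.
move=> nSx H fS; apply: nSx; apply: closed_approx H.
by apply: compact_closed => //; exact: finite_compact.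
Qed.

Section IntrinsicApproximation.
Variables (R : realType) (d J : nat) (f : 'I_J -> 'rV[R]_d -> 'rV[R]_d).
Variables (tau : 'I_J -> R) (C : set 'rV[R]_d).
Hypothesis hf : forall j, contracting_similarity (tau j) (f j).
Hypothesis hrat :
  forall j, f j @` rational_vectors R d `<=` rational_vectors R d.
Hypothesis hC : is_attractor f C.
Hypothesis hC2 : exists x y : 'rV[R]_d, [/\ C x, C y & x != y].

(** Given a centre [y] of denominator [b], take [Q] with [Phi Q < 1/(2b)] and [xi] within [1/(2bQ)]
    of [y]. A rational vector outside [C] differs from [y], so it is at distance at least [1/(bQ)]
    from [y], and half of this remains at [xi]. *)
Lemma extrinsic_not_improvable (Phi : nat -> R) : Phi @ \oo --> (0 : R) ->
  exists xi, (C `\` rational_vectors R d) xi /\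
    forall M, exists Q, (M <= Q)%N /\
      forall (p : 'rV[int]_d) (q : nat), (1 <= q <= Q)%N ->
        (rational_vectors R d `\` C) (ratvec R p q) ->
        Phi Q / Q%:R < `|xi - ratvec R p q|.
Proof.
move=> Phi0.
have exQ (nb : nat * nat) : exists Q,
    (0 < nb.2)%N -> [/\ (0 < Q)%N, (nb.1 <= Q)%N & Phi Q < (2 * nb.2%:R)^-1].
  case: nb => n [|b] /=; first by exists 0%N.
  have [|N _ HN] := (cvgrPdist_lt _ _).1 Phi0 (2 * b.+1%:R)^-1;
    first by rewrite invr_gt0 mulr_gt0.
  exists (maxn N n.+1); split; rewrite ?leq_max ?ltnS ?leqnn ?orbT ?leqnSn ?orbT//.
  have := HN (maxn N n.+1) (leq_maxl _ _); rewrite sub0r normrN.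
  exact/le_lt_trans/ler_norm.
have /choice[Qf QfP] := exQ.
have [|xi [xiC H]] := exists_fast_intrinsic_approx hf hC hrat hC2
    (Psi := fun n b => (2 * b%:R * (Qf (n, b))%:R)^-1).
  by move=> n b b0; have [Q0 _ _] := QfP (n, b) b0; rewrite invr_gt0 !mulr_gt0 ?ltr0n.
exists xi; split => // M; have [p [b [b0 Cy xiy]]] := H M.
have [Q0 MQ PhiQ] := QfP (M, b) b0; set Q := Qf (M, b) in Q0 MQ PhiQ xiy *.
exists Q; split => // p' q /andP[q0 qQ] [_ nC].
have bR : 0 < b%:R :> R by rewrite ltr0n.
have QR : 0 < Q%:R :> R by rewrite ltr0n.
have qR : 0 < q%:R :> R by rewrite ltr0n.
have ne : ratvec R p b != ratvec R p' q.
  by apply/eqP => e; apply: nC; rewrite -e.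
have := ratvec_dist_ge b0 q0 ne; rewrite -(subrKA xi).
move=> /le_trans/(_ (ler_normD _ _)); rewrite [X in _ <= X + _]distrC => dist.
have le1 : (b%:R * Q%:R)^-1 <= (b%:R * q%:R)^-1 :> R.
  by rewrite lef_pV2 ?posrE ?mulr_gt0// ler_pM2l// ler_nat.
have : Phi Q / Q%:R < (2 * b%:R)^-1 / Q%:R by rewrite ltr_pM2r// invr_gt0.
rewrite -invfM => PhiQ'.
have split2 : (b%:R * Q%:R)^-1 = (2 * b%:R * Q%:R)^-1 + (2 * b%:R * Q%:R)^-1 :> R.
  by field; rewrite !gt_eqF.
lra.
Qed.

(** The extra bound [n.+1^-1] makes the approximants accumulate at [xi]; as [xi] is irrational, they
    are infinitely many. *)
Lemma exists_intrinsically_approximable (Psi : nat -> R) :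
  (forall n, (1 <= n)%N -> 0 < Psi n) ->
  exists xi, intrinsically_approximable C Psi xi.
Proof.
move=> Psi0.
have [|xi [[Cxi nQ] H]] := exists_fast_intrinsic_approx hf hC hrat hC2
    (Psi := fun n b => Num.min (Psi b) n.+1%:R^-1).
  by move=> n b b0; rewrite lt_min Psi0// invr_gt0 ltr0n.
exists xi; split => //; apply: (@infinite_approached _ _ _ xi) => [[_ [/nQ]]//|e e0].
have [p [b [b0 Cy]]] := H (Num.bound e^-1); rewrite lt_min => /andP[yPsi ye].
exists (ratvec R p b).
  by split; [exists p, b | split => //; exact: rational_vectors_ratvec].
apply: lt_trans ye _; rewrite -[ltRHS]invrK ltf_pV2 ?posrE ?invr_gt0//.
apply: lt_trans (archi_boundP _) _; first by rewrite invr_ge0 ltW.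
by rewrite ltr_nat.
Qed.

(** Raising the exponent with the level [n] serves every exponent [N] at once: all levels from [N]
    on qualify. *)
Lemma exists_liouville_vector : exists xi, C xi /\ liouville_vector xi.
Proof.
have [|xi [[Cxi nQ] H]] := exists_fast_intrinsic_approx hf hC hrat hC2
    (Psi := fun n b => Num.min (b%:R ^- n) n.+1%:R^-1).
  by move=> n b b0; rewrite lt_min !invr_gt0 exprn_gt0 ?ltr0n.
exists xi; split => // N;
  apply: (@infinite_approached _ _ _ xi) => [[p [q [_ E _]]]|e e0].
  by apply: nQ; rewrite E; exact: rational_vectors_ratvec.
have [p [b [b0 Cy]]] := H (maxn N (Num.bound e^-1)); rewrite lt_min => /andP[yb ye].
exists (ratvec R p b).
  exists p, b; split => //; apply: lt_le_trans yb _.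
  have b1 : 1 <= b%:R :> R by rewrite ler1n.
  by rewrite lef_pV2 ?posrE ?exprn_gt0 ?ltr0n// ler_weXn2l// leq_maxl.
apply: lt_trans ye _; rewrite -[ltRHS]invrK ltf_pV2 ?posrE ?invr_gt0//.
apply: lt_le_trans (archi_boundP _) _; first by rewrite invr_ge0 ltW.
by rewrite ler_nat ltnW// ltnS leq_maxr.
Qed.

End IntrinsicApproximation.

(** * Extrinsic approximation *)

(** Large [Q] are rounded down to an integer [n] with [Q <= 2 * n], at the cost of a factor 2. For
    the bounded range below [N] one fixed integer vector outside [C] suffices, at the cost of the
    summand [D * N.+1]. *)
Lemma extrinsic_approx_of_large (R : realType) (d : nat) (C : set 'rV[R]_d) (K : R)
  (N : nat) :
  compact C -> (exists x y : 'rV[R]_d, [/\ C x, C y & x != y]) -> 0 < K ->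
  (forall xi n, C xi -> (N <= n)%N -> exists (p : 'rV[int]_d) (q : nat),
    [/\ (1 <= q <= n)%N, ~ C (ratvec R p q) & `|xi - ratvec R p q| <= K / n%:R]) ->
  exists K' : R, 0 < K' /\ forall (xi : 'rV[R]_d) (Q : R), C xi -> 1 < Q ->
    exists (p : 'rV[int]_d) (q : nat),
      [/\ (1 <= q)%N, q%:R <= Q, (rational_vectors R d `\` C) (ratvec R p q) &
          `|xi - ratvec R p q| <= K' / Q].
Proof.
move=> cC [x [y [_ _ xy]]] K0 H.
have [i _] : exists i, x 0 i != y 0 i.
  apply/existsP; apply: contraNT xy => /existsPn E.
  by apply/eqP/rowP => i; have := E i; rewrite negbK => /eqP.
have [B B0 CB] := compact_norm_le cC.
(* An integer vector of norm above [B]; its norm is read off at the coordinate [i], which exists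
   because [C] has two points. *)
pose m : 'rV[int]_d := const_mx (Num.bound B)%:Z.
pose D : R := B + `|ratvec R m 1|.
have D0 : 0 < D by rewrite /D ltr_wpDr.
have nCm : ~ C (ratvec R m 1).
  move=> /CB; rewrite leNgt => /negP; apply.
  apply: lt_le_trans (ler_coord_norm _ i).
  by rewrite !mxE invr1 mul1r -pmulrn normr_nat archi_boundP ?ltW.
exists (2 * K + D * N.+1%:R); split; first by rewrite addr_gt0// mulr_gt0.
move=> xi Q Cxi Q1; have Q0 : 0 < Q by rewrite (lt_trans ltr01).
have /andP[nQ Qn] := truncn_itv (ltW Q0); set n := Num.trunc Q in nQ Qn.
have [Nn|nN] := leqP N n.
  have [p [q [/andP[q1 qn] nC le]]] := H xi n Cxi Nn.
  exists p, q; split => //; first by apply: le_trans nQ; rewrite ler_nat.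
    by split => //; exact: rational_vectors_ratvec.
  apply: le_trans le _; have n0 : 0 < n%:R :> R by rewrite ltr0n (leq_trans q1).
  have Q2n : Q <= 2 * n%:R.
    have n1 : 1 <= n%:R :> R by rewrite ler1n (leq_trans q1).
    by rewrite -natr1 in Qn; lra.
  rewrite ler_pdivlMr// mulrAC ler_pdivrMr//.
  have : K * Q <= K * (2 * n%:R) by rewrite ler_pM2l.
  have : 0 <= D * N.+1%:R * n%:R by rewrite !mulr_ge0// ltW.
  lra.
exists m, 1%N; split => //; first exact: ltW.
  by split => //; exact: rational_vectors_ratvec.
rewrite ler_pdivlMr//.
have distD : `|xi - ratvec R m 1| <= D.
  by rewrite (le_trans (ler_normB _ _))// lerD2r CB.
have QN : Q <= N.+1%:R by rewrite (le_trans (ltW Qn))// ler_nat ltnW.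
have : `|xi - ratvec R m 1| * Q <= D * N.+1%:R by rewrite ler_pM// ltW.
lra.
Qed.

(** * Porosity under the open set condition *)

(** Pigeonhole on a grid of cubes of side [r]: two points in one cell are at sup distance less than
    [r]. *)
Lemma separated_size_le (R : realType) (d : nat) (B r : R) : 0 < r ->
  exists M, forall (T : eqType) (phi : T -> 'rV[R]_d) (s : seq T), uniq s ->
    (forall w, w \in s -> `|phi w| <= B) ->
    (forall w u, w \in s -> u \in s -> w != u -> r <= `|phi w - phi u|) ->
    (size s <= M)%N.
Proof.
move=> r0; pose N := Num.trunc (2 * B / r).
exists #|{ffun 'I_d -> 'I_N.+1}| => T phi s us phiB sep.
pose cell w : {ffun 'I_d -> 'I_N.+1} :=
  [ffun i => inord (Num.trunc ((phi w 0 i + B) / r))].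
have coordB w i : w \in s -> 0 <= phi w 0 i + B <= 2 * B.
  move=> ws; have := le_trans (ler_coord_norm (phi w) i) (phiB w ws).
  by rewrite ler_norml => /andP[l1 l2]; apply/andP; split; lra.
have inj : {in s &, injective cell}.
  move=> w u ws us' /ffunP E; apply/eqP; apply: contraT => wu.
  have := sep w u ws us' wu; rewrite leNgt => /negP[].
  apply: ltr_norm_coord => // i; rewrite !mxE.
  have cellE v : v \in s -> exists2 k : nat, cell v i = k :> nat &
      k%:R <= (phi v 0 i + B) / r < k.+1%:R.
    move=> vs; have /andP[b0 b1] := coordB v i vs.
    have q0 : 0 <= (phi v 0 i + B) / r by rewrite divr_ge0// ltW.
    exists (Num.trunc ((phi v 0 i + B) / r)); last exact: truncn_itv.
    by rewrite ffunE inordK// ltnS le_truncn// ler_pM2r// invr_gt0.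
  have [k kw /andP[k1 k2]] := cellE w ws; have [k' ku /andP[k3 k4]] := cellE u us'.
  have kk : k = k' by rewrite -kw -ku E.
  rewrite -kk in k3 k4; rewrite -natr1 in k2 k4.
  rewrite !ler_pdivlMr// in k1 k3; rewrite !ltr_pdivrMr// in k2 k4.
  by rewrite ltr_norml; apply/andP; split; lra.
rewrite -(size_map cell) -(card_uniqP _) ?max_card//.
by rewrite map_inj_in_uniq.
Qed.

(** A duplicate-free list in [P] of maximal length exhausts [P]. *)
Lemma maximal_uniq_seq (T : eqType) (P : T -> Prop) (M : nat) :
  (forall s, uniq s -> (forall x, x \in s -> P x) -> (size s <= M)%N) ->
  exists s, [/\ (size s <= M)%N, forall x, x \in s -> P x & forall x, P x -> x \in s].
Proof.
move=> H; pose Q k := `[< exists s,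
  [/\ uniq s, forall x, x \in s -> P x & size s = k] >].
have Q0 : exists k, Q k by exists 0%N; apply/asboolP; exists [::].
have QM k : Q k -> (k <= M)%N by move=> /asboolP[s [us sP <-]]; exact: H.
case: (ex_maxnP Q0 QM) => k /asboolP[s [us sP sk]] max.
exists s; split => //; first exact: H.
move=> x Px; apply: contraT => xs.
have : Q k.+1.
  apply/asboolP; exists (x :: s); split; rewrite /= ?xs ?sk// => y.
  by rewrite in_cons => /predU1P[->|/sP].
by move/max; rewrite ltnn.
Qed.

(** The vector that the linear part sends to [t *: v] has signed coordinates of [v] as entries, so
    it ranges over a finite set independent of [g]. *)
Lemma similarity_direction (R : realType) (d : nat) (t : R)
    (g : 'rV[R]_d -> 'rV[R]_d) (v : 'rV[R]_d) : similarity t g ->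
  exists theta : {ffun 'I_d -> 'I_d * bool},
    forall x c, g (x + c *: \row_i ((-1) ^+ (theta i).2 * v 0 (theta i).1)) =
      g x + (c * t) *: v.
Proof.
move=> simg; have [t0 _] := simg.
have [A gA] := similarity_affine simg; have tA := similarity_mx_norm simg gA.
have [u gu] := similarity_surjective simg (g 0 + t *: v).
have uA : u *m A = t *: v by apply: (addrI (g 0)); rewrite -gA.
have /choice[th thP] : forall i, exists js : 'I_d * bool,
  u 0 i = (-1) ^+ js.2 * v 0 js.1.
  move=> i; have [j [s /(_ u)]] := sup_norm_isometry_coord t0 tA i.
  rewrite uA mxE mulrAC -mulrA [t * v _ _]mulrC => /eqP;
    rewrite mulrA -subr_eq0 -mulrBl mulf_eq0 (gt_eqF t0) orbF subr_eq0 => /eqP E.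
  by exists (j, s); rewrite /= E mulrA -signr_addb addbb mul1r.
exists (finfun th) => x c.
have -> : \row_i ((-1) ^+ (finfun th i).2 * v 0 (finfun th i).1) = u.
  by apply/rowP => i; rewrite mxE ffunE thP.
by rewrite gA (gA x) mulmxDl -scalemxAl uA scalerA addrA.
Qed.

(** If [eps / n.+1] fails for every [n], the base points of the failures stay bounded because [C]
    is. At a cluster point of them the closed set [C] contains the whole segment. *)
Lemma segment_porous (R : realType) (d : nat) (C : set 'rV[R]_d) (u : 'rV[R]_d)
  (eps : R) :
  compact C -> 0 < eps ->
  (forall a, ~ (forall t, 0 <= t <= eps -> C (a + t *: u))) ->
  exists2 delta, 0 < delta <= eps & forall a, exists2 t0, 0 <= t0 <= eps - delta &
    forall t, t0 <= t <= t0 + delta -> ~ C (a + t *: u).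
Proof.
move=> cC e0 nseg.
have [//|H] := pselect (exists2 delta, 0 < delta <= eps & forall a,
  exists2 t0, 0 <= t0 <= eps - delta &
    forall t, t0 <= t <= t0 + delta -> ~ C (a + t *: u)).
pose del n : R := eps / n.+1%:R.
have del0 n : 0 < del n by rewrite divr_gt0.
have dele n : del n <= eps by rewrite ler_pdivrMr// ler_peMr ?ler1n// ltW.
have /choice[a aP] : forall n, exists a, forall t0, 0 <= t0 <= eps - del n ->
    exists2 t, t0 <= t <= t0 + del n & C (a + t *: u).
  move=> n; apply: contrapT => Hn; apply: H; exists (del n);
    first by rewrite del0 dele.
  move=> a; apply: contrapT => Ha; apply: Hn; exists a => t0 t01.
  apply: contrapT => Ht; apply: Ha; exists t0 => // t tt Ct; apply: Ht; by exists t.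
have [B B0 CB] := compact_norm_le cC.
have aB n : `|a n| <= B + eps * `|u|.
  have [|t /andP[t0 t1] Ct] := aP n 0; first by rewrite lexx subr_ge0 dele.
  rewrite -[a n](addrK (t *: u)) (le_trans (ler_normB _ _))// lerD ?CB// normrZ.
  by rewrite ler_wpM2r// ger0_norm// (le_trans t1)// add0r dele.
have [b _ bP] := compact_limit_point (@compact_norm_ball _ _ _) aB.
exfalso; apply: (nseg b) => t /andP[t0 t1].
apply: (closed_approx (compact_closed _ cC)) => // e e_gt0.
have e20 : 0 < e / 2 by rewrite divr_gt0.
pose N := Num.bound (2 * eps * (`|u| + 1) / e).
have [n Nn anb] := bP _ N e20.
(* The minimum keeps the window inside [[0, eps]], and the window still lies within [del n] of
   [t]. *)
have [|s /andP[s1 s2] Cs] := aP n (Num.min t (eps - del n)).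
  by rewrite le_min t0 subr_ge0 dele /= ge_min lexx orbT.
exists (a n + s *: u) => //.
have ts : `|t - s| <= del n.
  rewrite ler_norml; move: s1 s2; rewrite /Num.min; case: ifP => [_|/negbT];
    last rewrite -leNgt.
    by move=> s1 s2; apply/andP; split; lra.
  by move=> tle s1 s2; apply/andP; split; lra.
have du : del n * (`|u| + 1) < e / 2.
  rewrite /del mulrAC ltr_pdivrMr// -ltr_pdivrMl//.
  have : 2 * eps * (`|u| + 1) / e < N%:R.
    by apply: archi_boundP;
      rewrite divr_ge0 ?(ltW e_gt0)// !mulr_ge0// ?addr_ge0// ltW.
  have : N%:R <= n.+1%:R :> R by rewrite ler_nat (leq_trans Nn).
  move=> l1 l2; apply: le_lt_trans (lt_le_trans l2 l1).
  by rewrite le_eqVlt; apply/orP; left; apply/eqP; field; rewrite gt_eqF.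
have -> : b + t *: u - (a n + s *: u) = (b - a n) + (t - s) *: u.
  by rewrite scalerBl opprD addrACA.
rewrite (le_lt_trans (ler_normD _ _))// (splitr e) ltrD//; first by rewrite distrC.
rewrite normrZ (le_lt_trans _ du)// ler_pM// lerDl//.
Qed.

(* Words at which the contraction ratio first drops to [rho]. *)
Fixpoint stopping (R : realType) (J : nat) (tau : 'I_J -> R) (rho : R)
  (w : seq 'I_J) : bool :=
  if w is j :: w' then (rho < 1) && stopping tau (rho / tau j) w' else 1 <= rho.

Section OpenSetCondition.
Variables (R : realType) (d J : nat) (f : 'I_J -> 'rV[R]_d -> 'rV[R]_d).
Variables (tau : 'I_J -> R) (C : set 'rV[R]_d).
Hypothesis hf : forall j, contracting_similarity (tau j) (f j).
Hypothesis hC : is_attractor f C.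

Lemma stopping_ratio_le rho w :
  stopping tau rho w -> \prod_(j <- w) tau j <= rho.
Proof.
elim: w rho => [|j w IH] rho /=; first by rewrite big_nil.
move=> /andP[_ /IH]; rewrite big_cons ler_pdivlMr ?(tau_gt0 hf)//.
by rewrite mulrC.
Qed.

(** Before its last letter the ratio of the word still exceeds [rho], and one letter costs at most a
    factor [t]. The bound [rho * t <= 1] covers the empty word. *)
Lemma stopping_ratio_ge t rho w : 0 < t -> (forall j, t <= tau j) ->
  rho * t <= 1 -> stopping tau rho w -> rho * t <= \prod_(j <- w) tau j.
Proof.
move=> t0 tt; elim: w rho => [|j w IH] rho /=; first by rewrite big_nil.
move=> _ /andP[rho1 /IH]; have tj := tau_gt0 hf j; rewrite big_cons.
rewrite mulrAC ler_pdivrMr// mul1r ler_pdivrMr//.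
rewrite [_ * tau j]mulrC; apply.
by rewrite (le_trans _ (tt j))// ler_piMl// ltW.
Qed.

Lemma stopping_cover rho x : 0 < rho -> C x ->
  exists w y, [/\ stopping tau rho w, C y & x = foldr f y w].
Proof.
move=> rho0 Cx; have [t [/andP[t0 t1] tt]] := tau_le_max hf.
have [n] := expr_lt_eps (introT andP (conj t0 t1)) ler01 rho0.
rewrite mulr1 => /ltW; elim: n rho rho0 x Cx => [|n IH] rho rho0 x Cx trho.
  by exists [::], x.
have [rho1|rho1] := leP 1 rho; first by exists [::], x; split.
have [j [y [Cy ->]]] := attractor_map hC Cx; have tj := tau_gt0 hf j.
have [||w [z [sw Cz ->]]] := IH (rho / tau j) _ y Cy; first exact: divr_gt0.
  rewrite ler_pdivlMr// (le_trans _ trho)// exprSr ler_wpM2l// exprn_ge0//.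
by exists (j :: w), z; rewrite /= rho1.
Qed.

(** No stopping word is a proper prefix of another, so [w] and [u] differ at some letter, where the
    images of [O] separate. *)
Lemma stopping_disjoint (O : set 'rV[R]_d) rho w u a b :
  (forall j, f j @` O `<=` O) ->
  (forall i j, i != j -> (f i @` O) `&` (f j @` O) = set0) ->
  stopping tau rho w -> stopping tau rho u -> O a -> O b -> w != u ->
  foldr f a w != foldr f b u.
Proof.
move=> fO disj sw su Oa Ob.
have stay x s : O x -> O (foldr f x s).
  by move=> Ox; elim: s => //= j s IH; apply: (fO j); exists (foldr f x s).
elim: w u rho sw su => [|j w IH] [|i u] rho //=.
- by move=> rho1; rewrite ltNge rho1.
- by move=> /andP[+ _] rho1; rewrite ltNge rho1.
move=> /andP[_ sw] /andP[_ su]; have [ij|ji _] := eqVneq j i.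
  rewrite -ij in su *; rewrite eqseq_cons eqxx /= => /(IH _ _ sw su);
    apply: contra => /eqP E.
  by apply/eqP; exact: (similarity_inj (map_similarity hf j)).
apply/eqP => E; have : set0 (f j (foldr f a w)).
  rewrite -(disj _ _ ji); split; first by exists (foldr f a w) => //; exact: stay.
  by rewrite E; exists (foldr f b u) => //; exact: stay.
by [].
Qed.

Lemma tau_ge_min : exists2 t : R, 0 < t <= 1 & forall j, t <= tau j.
Proof.
exists (\big[Num.min/1]_(j < J) tau j); last by move=> j; exact: bigmin_le.
apply/andP; split; last exact: bigmin_le_id.
by apply: lt_bigmin => // j _; exact: tau_gt0 hf j.
Qed.

(** A packing argument. Each image of [U] under a stopping word contains a ball of radius
    [rho * t * r] about the image of [z], and these images are disjoint. Rescaled by [rho^-1], the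
    images of [z] are separated and bounded. *)
Lemma osc_cover (L : R) : open_set_condition f ->
  exists M, forall rho x, 0 < rho <= 1 -> exists s : seq (seq 'I_J),
    [/\ (size s <= M)%N, forall w, w \in s -> stopping tau rho w &
      forall c, C c -> `|c - x| <= rho * L ->
        exists2 w, w \in s & exists2 y, C y & c = foldr f y w].
Proof.
move=> [U [[z Uz] _ oU fU disj]].
have [t /andP[t0 t1] tt] := tau_ge_min.
have [r /= r0 zrU] : nbhs_ball z U by apply/nbhs_ballP; exact: open_nbhs_nbhs.
have [B B0 CB] := attractor_norm_le hC.
have tr0 : 0 < t * r by rewrite mulr_gt0.
have [M HM] := separated_size_le d (L + (`|z| + B)) tr0.
exists M => rho x /andP[rho0 rho1].
have rt1 : rho * t <= 1 by rewrite (le_trans _ rho1)// ler_piMr// ltW.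
have rV0 : 0 < rho^-1 by rewrite invr_gt0.
pose P w := stopping tau rho w /\ exists2 c, C c & `|foldr f c w - x| <= rho * L.
have [|s [sM sP Ps]] := @maximal_uniq_seq _ P M; last first.
  exists s; split => // [w /sP[]//|c Cc cx].
  have [w [y [sw Cy cE]]] := stopping_cover rho0 Cc.
  by exists w; [apply: Ps; split => //; exists y => //; rewrite -cE | exists y].
move=> s us sP; apply: (HM _ (fun w => rho^-1 *: (foldr f z w - x))) => //.
  move=> w /sP[sw [c Cc cx]].
  rewrite normrZ gtr0_norm// ler_pdivrMl// -(subrKA (foldr f c w)).
  rewrite (le_trans (ler_normD _ _))// mulrDr addrC lerD//.
  have [_ ->] := word_similarity hf w.
  rewrite ler_pM ?(ltW (ratio_gt0 hf _)) ?stopping_ratio_le//.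
  by rewrite (le_trans (ler_normB _ _))// lerD2l CB.
move=> w u /sP[sw _] /sP[su _] wu.
rewrite -scalerBr opprB addrA subrK normrZ gtr0_norm// leNgt ltr_pdivrMl//.
apply/negP => close.
have simw := word_similarity hf w;
  have [y yE] := similarity_surjective simw (foldr f z u).
have Uy : U y.
  apply: zrU; rewrite -ball_normE /=; have [w0 tw] := simw.
  rewrite -(ltr_pM2l w0) -tw yE (lt_le_trans close)// mulrA ler_pM2r//.
  exact: stopping_ratio_ge.
by have /eqP := stopping_disjoint fU disj sw su Uy Uz wu; rewrite yE.
Qed.

Variable v : 'rV[R]_d.
Hypothesis v0 : v != 0.
Hypothesis hv : ~ contains_segment_parallel C v.

Lemma no_parallel_segment a (l : R) : 0 < l ->
  ~ (forall t, 0 <= t <= l -> C (a + t *: v)).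
Proof.
move=> l0 H; apply: hv; exists a, (a + l *: v); split.
- by rewrite eq_sym -subr_eq0 addrAC subrr add0r scaler_eq0 (gt_eqF l0).
- by exists l; rewrite addrAC subrr add0r.
move=> _ [t + <-]; rewrite /= in_itv /= => /andP[t0 t1].
rewrite [_ - a]addrAC subrr add0r scalerA; apply: H.
by rewrite mulr_ge0 ?(ltW l0)//= ler_piMl// ltW.
Qed.

(** Pulling back by [w] turns the line along [v] into a line along some [u th] and the cylinder into
    [C]. Only finitely many [th] occur, so the least of their gaps works for all words. *)
Lemma cylinder_porous (eps : R) : 0 < eps -> exists2 delta, 0 < delta <= eps &
  forall w a, exists2 t0, 0 <= t0 <= eps - delta &
    forall t c, t0 <= t <= t0 + delta -> C c ->
      foldr f c w != a + (t * \prod_(j <- w) tau j) *: v.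
Proof.
move=> e0; have [_ cC _] := hC.
pose u (th : {ffun 'I_d -> 'I_d * bool}) := \row_i ((-1) ^+ (th i).2 * v 0 (th i).1).
(* For a direction realized by a word, a segment in [C] along [u th] would be mapped to one along
   [v]. Other directions get the dummy gap [eps]. *)
pose good th := exists w, forall x c,
  foldr f (x + c *: u th) w = foldr f x w + (c * \prod_(j <- w) tau j) *: v.
have /choice[del delP] : forall th, exists delta, 0 < delta <= eps /\ (good th ->
    forall a, exists2 t0, 0 <= t0 <= eps - delta &
      forall t, t0 <= t <= t0 + delta -> ~ C (a + t *: u th)).
  move=> th; have [[w wP]|ng] := pselect (good th);
    last by exists eps; rewrite e0 lexx.
  have [|delta delta0 H] := @segment_porous _ _ C (u th) eps cC e0;
    last by exists delta.
  move=> a H; apply: (@no_parallel_segment (foldr f a w)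
    (eps * \prod_(j <- w) tau j)).
    by rewrite mulr_gt0// (ratio_gt0 hf).
  move=> t /andP[t0 te]; have w0 := ratio_gt0 hf w.
  have -> : t = t / (\prod_(j <- w) tau j) * \prod_(j <- w) tau j
    by rewrite divfK ?gt_eqF.
  rewrite -wP; apply: (word_attractor hC); apply: H.
  by rewrite divr_ge0 ?(ltW w0)//= ler_pdivrMr.
pose delta := \big[Num.min/eps]_th del th.
exists delta.
  apply/andP; split; last exact: bigmin_le_id.
  by apply: lt_bigmin => // th _; have [/andP[]] := delP th.
move=> w a; have [th thP] := similarity_direction v (word_similarity hf w).
have [/andP[d0 de] H] := delP th.
have [y ya] := similarity_surjective (word_similarity hf w) a.
have [|t0 /andP[t00 t0e] tP] := H _ y; first by exists w.
have dd : delta <= del th by exact: bigmin_le.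
exists t0; first by rewrite t00 (le_trans t0e)// lerD2l lerN2.
move=> t c /andP[l1 l2] Cc; rewrite -ya -thP; apply/eqP => E; apply: (tP t).
  by rewrite l1 (le_trans l2)// lerD2l.
by rewrite -(similarity_inj (word_similarity hf w) E).
Qed.

(** Induction on the number of cylinders: inside the gap of length [k * rho] left by the others, the
    porosity of one more cylinder with [eps = k] leaves length [delta * p], at least
    [delta * t * rho]. *)
Lemma cylinders_porous m : exists2 k : R, 0 < k <= 1 &
  forall rho (s : seq (seq 'I_J)), 0 < rho <= 1 -> (size s <= m)%N ->
  (forall w, w \in s -> stopping tau rho w) ->
  forall a, exists2 t0, 0 <= t0 <= rho - k * rho &
    forall t w c, t0 <= t <= t0 + k * rho -> w \in s -> C c ->
      foldr f c w != a + t *: v.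
Proof.
elim: m => [|m [k /andP[k0 k1] IH]].
  by exists 1 => [|rho [|]//]; rewrite ?ltr01 ?lexx// => *; exists 0;
    rewrite ?mul1r ?subrr ?lexx.
have [t /andP[t0 t1] tt] := tau_ge_min.
have [delta /andP[d0 dk] H] := cylinder_porous k0.
have dt0 : 0 < delta * t by rewrite mulr_gt0.
have dtd : delta * t <= delta by rewrite ler_piMr// ltW.
exists (delta * t) => [|rho [|w s] rho01 sm ss a].
- by rewrite dt0 (le_trans dtd)// (le_trans dk).
- exists 0 => //; have /andP[r0 r1] := rho01.
  by rewrite lexx /= subr_ge0 ler_piMl ?(ltW r0)// (le_trans dtd)// (le_trans dk).
have /andP[r0 r1] := rho01.
have [|w' w's|s0 /andP[s00 s0k] sP] := IH rho s rho01 _ _ a; first by [].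
  by apply: ss; rewrite in_cons w's orbT.
have sw : stopping tau rho w by apply: ss; rewrite mem_head.
have [q0 /andP[q00 q0k] qP] := H w (a + s0 *: v).
set p := \prod_(j <- w) tau j in qP.
have p0 : 0 < p := ratio_gt0 hf w.
have pr : p <= rho by exact: stopping_ratio_le.
have rp : rho * t <= p.
  by apply: stopping_ratio_ge => //; rewrite (le_trans _ r1)// ler_piMr// ltW.
have dp : delta * t * rho <= delta * p by rewrite -mulrA ler_pM2l// mulrC.
have qp : (q0 + delta) * p <= k * rho.
  rewrite ler_pM ?addr_ge0 ?(ltW p0) ?(ltW d0)//; lra.
exists (s0 + q0 * p).
  by rewrite addr_ge0 ?mulr_ge0 ?(ltW p0)//=; rewrite mulrDl in qp; lra.
move=> t' w' c /andP[l1 l2]; rewrite in_cons => /predU1P[-> {w'}|w's] Cc.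
  have := qP ((t' - s0) / p) c;
    rewrite divfK ?gt_eqF// -addrA -scalerDl [s0 + _]addrC subrK.
  apply => //; rewrite ler_pdivlMr// ler_pdivrMr// mulrDl; apply/andP; split; lra.
apply: sP w's Cc; apply/andP; split; last by rewrite mulrDl in qp; lra.
by rewrite (le_trans _ l1)// lerDl mulr_ge0// ltW.
Qed.

Lemma osc_porous : open_set_condition f -> exists2 k : R, 0 < k <= 1 &
  forall rho a, 0 < rho <= 1 -> exists2 t0, 0 <= t0 <= rho - k * rho &
    forall t, t0 <= t <= t0 + k * rho -> ~ C (a + t *: v).
Proof.
move=> osc; have [M HM] := osc_cover `|v| osc.
have [k /andP[k0 k1] H] := cylinders_porous M; exists k; first by rewrite k0.
move=> rho a rho01; have [s [sM ss sP]] := HM rho a rho01.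
have [t0 /andP[t00 t0k] tP] := H rho s rho01 sM ss a.
exists t0 => [|t /andP[l1 l2] Cat]; first by rewrite t00.
have [|w ws [y Cy E]] := sP _ Cat.
  rewrite addrAC subrr add0r normrZ ler_wpM2r// ger0_norm; last exact: le_trans l1.
  lra.
by have /eqP := tP t w y (introT andP (conj l1 l2)) ws Cy; rewrite -E.
Qed.

End OpenSetCondition.

(** * Rational vectors in the gaps along an integral direction *)

Lemma floor_ratvec_dist (R : realType) (d : nat) (xi : 'rV[R]_d) (n : nat) :
  (0 < n)%N ->
  `|xi - ratvec R (\row_i Num.floor (n%:R * xi 0 i)) n| <= n%:R^-1.
Proof.
move=> n0; have nR : 0 < n%:R :> R by rewrite ltr0n.
apply: ler_norm_coord => [|i]; first by rewrite invr_ge0.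
rewrite !mxE -{1}[xi 0 i](mulKf (lt0r_neq0 nR)) -mulrBr.
rewrite normrM ger0_norm ?invr_ge0// ler_piMr ?invr_ge0//.
have /andP[l1 l2] := floor_itv (n%:R * xi 0 i).
rewrite ger0_norm ?subr_ge0//; rewrite intrD in l2; lra.
Qed.

(** As [v] is integral, moving along it by multiples of [1/n] keeps the denominator [n]. In [K], the
    1 is the rounding error and [|V| / k] the length of the searched segment. *)
Lemma osc_extrinsic (R : realType) (d J : nat) (f : 'I_J -> 'rV[R]_d -> 'rV[R]_d)
    (tau : 'I_J -> R) (C : set 'rV[R]_d) (v : 'rV[int]_d) :
  (forall j, contracting_similarity (tau j) (f j)) -> is_attractor f C ->
  open_set_condition f -> v != 0 ->
  ~ contains_segment_parallel C (map_mx intr v) ->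
  exists (K : R) (N : nat), 0 < K /\
    forall xi n, C xi -> (N <= n)%N -> exists (p : 'rV[int]_d) (q : nat),
      [/\ (1 <= q <= n)%N, ~ C (ratvec R p q) & `|xi - ratvec R p q| <= K / n%:R].
Proof.
move=> hf hC osc v0 hv.
have vR0 : map_mx intr v != 0 :> 'rV[R]_d.
  apply: contra v0 => /eqP/rowP E; apply/eqP/rowP => i.
  by have /eqP := E i; rewrite !mxE intr_eq0 => /eqP.
have [k /andP[k0 k1] H] := osc_porous hf hC vR0 hv osc.
set V : 'rV[R]_d := map_mx intr v in vR0 H *.
exists (1 + `|V| / k), (Num.bound k^-1).+1; split.
  by rewrite ltr_wpDr// divr_ge0// ltW.
move=> xi n Cxi Nn; have n0 : (0 < n)%N by exact: leq_trans Nn.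
have nR : 0 < n%:R :> R by rewrite ltr0n.
have kn : k^-1 < n%:R.
  apply: lt_le_trans (archi_boundP _) _; first by rewrite invr_ge0 ltW.
  by rewrite ler_nat ltnW.
(* Chosen so that the gap [k * rho] has parameter length exactly [1/n] and thus contains a multiple
   of [1/n]; [N] ensures [rho <= 1]. *)
pose rho := (k * n%:R)^-1.
have rho0 : 0 < rho by rewrite invr_gt0 mulr_gt0.
have rho1 : rho <= 1 by rewrite invf_le1 ?mulr_gt0// -ler_pdivrMl// mulr1 ltW.
have kr : k * rho = n%:R^-1 by rewrite /rho invfM mulVKf ?gt_eqF.
pose p0 : 'rV[int]_d := \row_i Num.floor (n%:R * xi 0 i).
have [|t0 /andP[t00 t0r] tP] := H rho (ratvec R p0 n); first by rewrite rho0.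
rewrite kr in t0r tP.
pose l := Num.floor (n%:R * t0) + 1.
have /andP[l1 l2] := floor_itv (n%:R * t0).
have lt : t0 <= l%:~R / n%:R <= t0 + n%:R^-1.
  rewrite ler_pdivlMr// ler_pdivrMr// mulrDl mulVf ?gt_eqF// mulrC (ltW l2)/=.
  by rewrite /l intrD lerD2r.
have E : ratvec R (p0 + l *: v) n = ratvec R p0 n + (l%:~R / n%:R) *: V.
  by apply/rowP => i; rewrite !mxE intrD intrM; ring.
exists (p0 + l *: v), n; split; first by rewrite n0 leqnn.
  by rewrite E; exact: tP.
rewrite E opprD addrA (le_trans (ler_normB _ _))// mulrDl mul1r lerD//.
  exact: floor_ratvec_dist.
have /andP[l3 l4] := lt.
rewrite normrZ ger0_norm; last exact: le_trans l3.
rewrite mulrC -mulrA ler_wpM2l// -invfM; apply: le_trans l4 _.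
by rewrite -/rho; lra.
Qed.

(** * Attractors of small dimension *)

Lemma dvdn_gcd_mul (a b h : nat) : (gcdn (a * b) h %| gcdn a h * gcdn b h)%N.
Proof.
rewrite muln_gcdl dvdn_gcd muln_gcdr dvdn_gcd dvdn_gcdl /=.
by rewrite (dvdn_mull _ (dvdn_gcdr _ _)) (dvdn_mulr _ (dvdn_gcdr _ _)).
Qed.

Lemma gcd_biglcm_dvdn (g : nat -> nat) (h k : nat) :
  (gcdn (\big[lcmn/1]_(i < k) g i) h %| \prod_(i < k) gcdn (g i) h)%N.
Proof.
elim: k => [|k IH]; first by rewrite !big_ord0 gcd1n.
rewrite !big_ord_recr /=; apply: dvdn_trans (dvdn_mul IH (dvdnn _)).
apply: dvdn_trans (dvdn_gcd_mul _ _ _).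
by rewrite dvdn_gcd dvdn_gcdr andbT (dvdn_trans (dvdn_gcdl _ _))// dvdn_lcm
  dvdn_mulr ?dvdn_mull.
Qed.

(* The gcds of q with the members of a short window are nearly coprime, so
   their product is not much larger than q and the smallest is small. *)
Lemma small_gcd_window (t q : nat) (p : int) : (0 < t)%N -> (0 < q)%N ->
  exists2 i : nat, (i < t)%N & (gcdn q (absz (p + i%:Z)%R) ^ t <= q * t ^ (t * t))%N.
Proof.
move=> t0 q0; pose g (i : nat) := gcdn q (absz (p + i%:Z)%R).
have g0 i : (0 < g i)%N by rewrite gcdn_gt0 q0.
pose L k := (\big[lcmn/1]_(i < k) g i)%N.
have Lq k : (L k %| q)%N.
  by apply/dvdn_biglcmP => i _; exact: dvdn_gcdl.
have gg i j : (i < j)%N -> (j < t)%N -> (gcdn (g i) (g j) <= t)%N.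
  move=> ij jt; apply: (@leq_trans (j - i)); last lia.
  apply: dvdn_leq; first lia.
  have : (gcdn (g i) (g j) %| (p + j%:Z) - (p + i%:Z))%Z.
    apply: rpredB; rewrite /dvdz /= unfold_in.
      exact: dvdn_trans (dvdn_gcdr _ _) (dvdn_gcdr _ _).
    exact: dvdn_trans (dvdn_gcdl _ _) (dvdn_gcdr _ _).
  rewrite (_ : (p + j%:Z) - (p + i%:Z) = (j - i)%N%:Z); first by [].
  lia.
(* Adding [g k] to the lcm loses at most their gcd, which divides a product of fewer than [t]
   pairwise gcds, each at most [t]. *)
have prod_le k : (k <= t)%N -> (\prod_(i < k) g i <= L k * t ^ (t * k))%N.
  elim: k => [|k IH] kt; first by rewrite /L !big_ord0 muln0.
  rewrite big_ord_recr /L big_ord_recr /= -/(L k).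
  have H : (gcdn (L k) (g k) <= t ^ t)%N.
    apply: (@leq_trans (\prod_(i < k) gcdn (g i) (g k))%N).
      apply: dvdn_leq; last exact: gcd_biglcm_dvdn.
      by rewrite prodn_gt0// => i; rewrite gcdn_gt0 g0.
    apply: (@leq_trans (\prod_(i < k) t)%N);
      first by apply: leq_prod => i _; exact: gg.
    by rewrite big_const_ord iter_muln_1 leq_pexp2l// ltnW.
  apply: (leq_trans (leq_mul (IH (ltnW kt)) (leqnn _))).
  rewrite mulnAC -(muln_lcm_gcd (L k) (g k)) -mulnA leq_mul2l mulnS expnD leq_mul2r.
  by rewrite H !orbT.
have [i _ imin] : exists2 i : 'I_t, true & forall j : 'I_t, (g i <= g j)%N.
  by case: (@arg_minnP _ (Ordinal t0) xpredT (fun i : 'I_t => g i) isT) => i _ im;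
    exists i => // j; exact: im.
exists i => //; rewrite -/(g i).
have -> : (g i ^ t = \prod_(j < t) g i)%N by rewrite big_const_ord iter_muln_1.
apply: (leq_trans (leq_prod (fun j _ => imin j))).
apply: leq_trans (prod_le t (leqnn _)) _.
by rewrite leq_mul2r dvdn_leq ?orbT.
Qed.

(** Cross-multiplication gives [gcdn p a * q = gcdn q b * p], and the equal gcds cancel. *)
Lemma ratr_eq_gcd (R : realType) (a b : int) (p q : nat) : (0 < p)%N -> (0 < q)%N ->
  p%:R^-1 * a%:~R = q%:R^-1 * b%:~R :> R ->
  gcdn p (absz a) = gcdn q (absz b) -> p = q.
Proof.
move=> p0 q0 E g.
have p0R : p%:R != 0 :> R by rewrite pnatr_eq0 -lt0n.
have q0R : q%:R != 0 :> R by rewrite pnatr_eq0 -lt0n.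
have {}E : a * q%:Z = b * p%:Z.
  apply: (@intr_inj R); rewrite !intrM -!pmulrn.
  apply: (mulIf (invr_neq0 p0R)); rewrite mulfK//.
  apply: (mulIf (invr_neq0 q0R)); rewrite mulrAC mulfK// mulrC E mulrC //.
have {}E : (absz a * q = absz b * p)%N by rewrite -(absz_nat q) -abszM E abszM.
have H : (gcdn (p * q) (absz a * q) = gcdn (q * p) (absz b * p))%N by rewrite E mulnC.
rewrite -!muln_gcdl g in H; apply/esym/eqP.
by rewrite -(eqn_pmul2l (m := gcdn q (absz b))) ?H// gcdn_gt0 q0.
Qed.

(* Sending q to the cylinder of level m that contains p q / q and to the gcd of
   q and the i0-th numerator is injective on (n, 2n]. *)
Lemma low_dim_count (R : realType) (d J : nat) (f : 'I_J -> 'rV[R]_d -> 'rV[R]_d)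
    (tau : 'I_J -> R) (C : set 'rV[R]_d) (tmax B : R) (i0 : 'I_d)
    (G m n : nat) (p : nat -> 'rV[int]_d) :
  (forall j, contracting_similarity (tau j) (f j)) -> is_attractor f C ->
  (forall j, tau j <= tmax) -> (forall x, C x -> `|x| <= B) ->
  tmax ^+ m * (2 * B) * (4 * n%:R ^+ 2) < 1 ->
  (forall q, (n < q <= n.*2)%N -> C (ratvec R (p q) q) /\
     (gcdn q (absz (p q ord0 i0)) <= G)%N) ->
  (n <= J ^ m * G.+1)%N.
Proof.
move=> hf hC tt CB small H.
have [->//|n0] := posnP n.
have nR : 0 < n%:R :> R by rewrite ltr0n.
pose den (i : 'I_n) := (n + i.+1)%N.
have denP i : (n < den i <= n.*2)%N by have := ltn_ord i; rewrite /den; lia.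
have den0 i : (0 < den i)%N by rewrite /den; lia.
have /choice[w wP] : forall i : 'I_n, exists w : m.-tuple 'I_J,
    exists2 y, C y & ratvec R (p (den i)) (den i) = foldr f y w.
  move=> i; have [Cx _] := H _ (denP i).
  have [w [y [wm Cy E]]] := attractor_word hC m Cx.
  have wm' : size w == m by rewrite wm.
  by exists (Tuple wm'), y.
pose F (i : 'I_n) : m.-tuple 'I_J * 'I_G.+1 :=
  (w i, inord (gcdn (den i) (absz (p (den i) ord0 i0)))).
suff Finj : injective F.
  by have := leq_card F Finj; rewrite card_prod card_tuple !card_ord.
move=> i j /pair_equal_spec[wij /(congr1 val)].
rewrite /= !inordK ?ltnS; try by have [_] := H _ (denP i); have [_] := H _ (denP j).
move=> gij.
apply/val_inj/succn_inj/(@addnI n).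
apply: (@ratr_eq_gcd R _ _ _ _ (den0 i) (den0 j) _ gij).
(* Distinct fractions would be at least [1/(4n^2)] apart, more than the diameter of their common
   cylinder. *)
apply/eqP; apply: contraT => /(ratr_dist_ge (den0 i) (den0 j));
  rewrite leNgt => /negP[].
have [y Cy Ey] := wP i; have [z Cz Ez] := wP j.
have := ler_coord_norm (ratvec R (p (den i)) (den i) -
  ratvec R (p (den j)) (den j)) i0.
rewrite !mxE => /le_lt_trans; apply; rewrite Ey Ez -wij.
apply: le_lt_trans (cylinder_diam hf (w i) tt CB Cy Cz) _; rewrite size_tuple.
have n20 : 0 < 4 * n%:R ^+ 2 :> R by rewrite mulr_gt0// exprn_gt0.
have : tmax ^+ m * (2 * B) < (4 * n%:R ^+ 2)^-1 by rewrite -[ltRHS]mul1r ltr_pdivlMr.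
move=> /lt_le_trans; apply.
rewrite lef_pV2 ?posrE ?mulr_gt0 ?ltr0n//.
have den_le k : (den k)%:R <= 2 * n%:R :> R.
  by have /andP[_] := denP k; rewrite -natrM mul2n ler_nat.
have -> : 4 * n%:R ^+ 2 = (2 * n%:R) * (2 * n%:R) :> R by ring.
by rewrite ler_pM.
Qed.

Lemma half_bounds (k n : nat) : (0 < k)%N -> (k.*2 <= n)%N ->
  [/\ (k <= n./2)%N, (0 < n./2)%N, (0 < n)%N, (n./2.*2 <= n)%N & (n <= 3 * n./2)%N].
Proof. by move=> k0 kn; split; lia. Qed.

(** If every candidate with denominator in [(n, 2n]] lay in [C], the count would give
    [n <= J^m * G.+1], where [J^m] is of order at most [n^(2D)] and [G] of order [n^(1/t)]. As
    [2D < 1], this fails for large [t] and [n]. *)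
Lemma low_dim_extrinsic (R : realType) (d J : nat) (f : 'I_J -> 'rV[R]_d -> 'rV[R]_d)
    (tau : 'I_J -> R) (C : set 'rV[R]_d) (tmax : R) :
  (forall j, contracting_similarity (tau j) (f j)) -> is_attractor f C ->
  (exists x y : 'rV[R]_d, [/\ C x, C y & x != y]) ->
  (0 < J)%N -> 0 < tmax < 1 -> (forall j, tau j <= tmax) -> J%:R ^+ 2 * tmax < 1 ->
  exists (K : R) (N : nat), 0 < K /\
    forall xi n, C xi -> (N <= n)%N -> exists (p : 'rV[int]_d) (q : nat),
      [/\ (1 <= q <= n)%N, ~ C (ratvec R p q) & `|xi - ratvec R p q| <= K / n%:R].
Proof.
move=> hf hC [x [y [_ _ xy]]] J0 /andP[t0 t1] tt Jt.
have [i0 _] : exists i, x 0 i != y 0 i.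
  apply/existsP; apply: contraNT xy => /existsPn E.
  by apply/eqP/rowP => i; have := E i; rewrite negbK => /eqP.
have [B [B1 CB]] : exists B : R, 1 <= B /\ forall x, C x -> `|x| <= B.
  have [B _ CB] := attractor_norm_le hC; exists (Num.max 1 B).
  by rewrite le_max lexx; split => // z /CB zB; rewrite le_max zB orbT.
have B0 : 0 < B by rewrite (lt_le_trans ltr01).
have JR : 0 < J%:R :> R by rewrite ltr0n.
have Jt01 : 0 <= J%:R ^+ 2 * tmax < 1 by rewrite Jt mulr_ge0// ?exprn_ge0 ltW.
(* The window length [t = r + 1] satisfies [(J^2 * tmax)^t < tmax], which is exactly [theta < 1]. *)
have [[|r]] := expr_lt_eps Jt01 ler01 t0; first by rewrite mulr1 expr0 ltNge (ltW t1).
rewrite mulr1 => Jr; set t := r.+1 in Jr.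
pose theta := J%:R ^+ (2 * t) * tmax ^+ r.
have theta01 : 0 <= theta < 1.
  rewrite /theta mulr_ge0 ?exprn_ge0 ?(ltW t0)//=.
  by move: Jr; rewrite exprMn -exprM [tmax ^+ t]exprSr mulrA -[ltRHS]mul1r ltr_pM2r.
(* Constants for the final comparison: [G.+1 ^ t <= T * n], [c2] bounds [(tmax^m * n^2)^r] from
   below, and [N] forces [m0 <= m]. *)
pose T := (2 ^ t.+1 * t ^ (t * t))%N.
pose c2 := (tmax / (8 * B)) ^+ r.
have c20 : 0 < c2 by rewrite exprn_gt0// divr_gt0// mulr_gt0.
have [m0 m0P] := expr_lt_eps theta01 (exprn_ge0 2 (ler0n R T)) c20.
pose N := Num.bound (tmax ^- m0).
(* Applied to [n./2], this yields denominators up to [n]; the factor 3 comes from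
   [n <= 3 * n./2]. *)
suff main n xi : (maxn 1 N <= n)%N -> C xi -> exists (p : 'rV[int]_d) (q : nat),
    [/\ (n < q <= n.*2)%N, ~ C (ratvec R p q) & `|xi - ratvec R p q| <= t%:R / n%:R].
  exists (3 * t%:R), (maxn 1 N).*2; split => [|xi n Cxi Nn];
    first by rewrite mulr_gt0 ?ltr0n.
  have [half_ge half_gt0 n_gt0 half_le n_le] := half_bounds (leq_maxl 1 N) Nn.
  have [p [q [/andP[q1 q2] nC le]]] := main n./2 xi half_ge Cxi.
  exists p, q; split => //; first by rewrite (leq_trans _ q1)// (leq_trans q2).
  apply: le_trans le _.
  rewrite ler_pdivrMr ?ltr0n// mulrAC ler_pdivlMr ?ltr0n//.
  by rewrite [3 * _]mulrC -mulrA ler_wpM2l// -natrM ler_nat.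
rewrite geq_max => /andP[n1 Nn] Cxi; apply: contrapT => noQ.
have nR : 0 < n%:R :> R by rewrite ltr0n.
have [G [GP Gle]] : exists G, (forall g, g ^ t <= n.*2 * t ^ (t * t) -> g <= G)%N /\
    (G.+1 ^ t <= T * n)%N.
  pose P g := (g ^ t <= n.*2 * t ^ (t * t))%N.
  have P1 : exists g, P g.
    by exists 1%N; rewrite /P exp1n muln_gt0 double_gt0 n1 expn_gt0.
  have PM g : P g -> (g <= n.*2 * t ^ (t * t))%N.
    apply: leq_trans; case: g => [|g]//; rewrite -{1}[g.+1]expn1 leq_pexp2l//.
  case: (ex_maxnP P1 PM) => G PG GM; exists G; split => //.
  apply: (@leq_trans ((2 * G) ^ t)%N).
    rewrite leq_exp2r//; have := GM 1%N;
      rewrite /P exp1n muln_gt0 double_gt0 n1 expn_gt0 /= => /(_ isT) G1.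
    by rewrite mul2n -addnn -addn1 leq_add2l.
  rewrite expnMn /T expnS -!mulnA [X in (_ <= X)%N]mulnCA leq_mul2l; apply/orP; right.
  by rewrite [(_ * n)%N]mulnC mulnA mul2n.
have /choice[p pP] : forall q, exists p : 'rV[int]_d, (n < q <= n.*2)%N ->
    `|xi - ratvec R p q| <= t%:R / n%:R /\ (gcdn q (absz (p ord0 i0)) <= G)%N.
  move=> q; have [/andP[q1 q2]|nq] := boolP (n < q <= n.*2)%N; last by exists 0.
  have q0 : (0 < q)%N by exact: leq_ltn_trans q1.
  have qR : 0 < q%:R :> R by rewrite ltr0n.
  pose P0 : 'rV[int]_d := \row_i Num.floor (q%:R * xi 0 i).
  have [k kt kg] := @small_gcd_window t q (P0 0 i0) isT q0.
  (* Only the [i0]-th numerator is shifted, by [k < t], so the error is at most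
     [(k + 1)/q <= t/q]. *)
  pose P1 : 'rV[int]_d := P0 + k%:Z *: delta_mx 0 i0.
  exists P1 => _; split; last first.
    apply: GP; rewrite !mxE !eqxx mulr1; move: kg; rewrite !mxE => kg.
    by apply: leq_trans kg _; rewrite leq_mul2r q2 orbT.
  have tn : t%:R / q%:R <= t%:R / n%:R :> R.
    by rewrite ler_wpM2l// lef_pV2 ?posrE// ler_nat ltnW.
  apply: le_trans tn.
  have -> : ratvec R P1 q = ratvec R P0 q + (k%:R / q%:R) *: delta_mx 0 i0.
    by apply/rowP => i; rewrite !mxE eqxx /= intrD intrM; case: (i == i0);
      rewrite /= -pmulrn; ring.
  rewrite opprD addrA (le_trans (ler_normB _ _))//.
  apply: (@le_trans _ _ (q%:R^-1 + k%:R / q%:R)).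
    rewrite lerD//; first exact: floor_ratvec_dist.
    by rewrite normrZ norm_delta_row mulr1 ger0_norm// divr_ge0.
  by rewrite -{1}[q%:R^-1]mul1r -mulrDl ler_pM2r ?invr_gt0// -natr1 addrC lerD2r
    ler_nat.
(* The least admissible level: minimality gives the reverse bound up to the factor [tmax], and level
   0 uses [8 * B * n^2 >= 1]. *)
have [m [mlt mge]] : exists m, tmax ^+ m * (2 * B) * (4 * n%:R ^+ 2) < 1 /\
    tmax <= tmax ^+ m * (8 * B * n%:R ^+ 2).
  have E m : tmax ^+ m * (2 * B) * (4 * n%:R ^+ 2) =
    tmax ^+ m * (8 * B * n%:R ^+ 2) by ring.
  have X0 : 0 <= 8 * B * n%:R ^+ 2 by rewrite !mulr_ge0// ?exprn_ge0// ltW.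
  have exm : exists m, tmax ^+ m * (8 * B * n%:R ^+ 2) < 1.
    by apply: expr_lt_eps => //; rewrite (ltW t0) t1.
  case: (ex_minnP exm) => -[|m] mlt mmin.
    exists 0%N; rewrite E; split => //; rewrite expr0 mul1r (le_trans (ltW t1))//.
    have nn : 1 <= n%:R ^+ 2 :> R by rewrite exprn_ege1// ler1n.
    by rewrite mulr_ege1//; lra.
  exists m.+1; rewrite E; split => //;
    rewrite exprS -mulrA ler_peMr ?(ltW t0)// leNgt.
  by apply/negP => /mmin; rewrite ltnn.
have nle : (n <= J ^ m * G.+1)%N.
  apply: (@low_dim_count _ _ _ f tau C tmax B i0 G m n p) => // q qn.
  have [le g] := pP q qn; split => //; apply: contrapT => nC; apply: noQ.
  by exists (p q), q.
have [mm|mm] := ltnP m m0.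
  have : N%:R <= n%:R :> R by rewrite ler_nat.
  rewrite leNgt => /negP; apply.
  apply: lt_trans (archi_boundP _); last by rewrite invr_ge0 exprn_ge0// ltW.
  have tm : tmax ^+ m0 <= tmax ^+ m by rewrite ler_wiXn2l ?(ltW t0) ?(ltW t1)// ltnW.
  have tm0 : 0 < tmax ^+ m0 by rewrite exprn_gt0.
  rewrite -[ltRHS]mul1r ltr_pdivlMr//.
  apply: le_lt_trans mlt.
  have n1R : 1 <= n%:R :> R by rewrite ler1n.
  have : n%:R * tmax ^+ m0 <= (8 * B * n%:R ^+ 2) * tmax ^+ m.
    rewrite ler_pM ?(ltW nR) ?(ltW tm0)// expr2 mulrA ler_peMl ?(ltW nR)//.
    by rewrite mulr_ege1//; lra.
  by move=> h; apply: le_trans h _; rewrite le_eqVlt; apply/orP; left; apply/eqP;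
    ring.
(* Raising the count to the power [2 * t] turns [G.+1] into [T^2 * n^2]; cancelling [n^2] leaves the
   exponent [2 * r]. *)
have Jle : (n%:R : R) ^+ (2 * t) <= J%:R ^+ (2 * t) ^+ m * T%:R ^+ 2 * n%:R ^+ 2.
  have : (n ^ (2 * t) <= (J ^ (2 * t)) ^ m * T ^ 2 * n ^ 2)%N.
    apply: (@leq_trans ((J ^ m * G.+1) ^ (2 * t))%N); first by rewrite leq_exp2r.
    rewrite expnMn -!expnM [(m * _)%N]mulnC -[X in (_ <= X)%N]mulnA leq_mul2l;
      apply/orP; right.
    by rewrite [(2 * t)%N]mulnC expnM -expnMn leq_exp2r.
  by rewrite -(ler_nat R) !natrM !natrX.
have n2 : 0 < n%:R ^+ 2 :> R by rewrite exprn_gt0.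
have {}Jle : (n%:R : R) ^+ (2 * r) <= J%:R ^+ (2 * t) ^+ m * T%:R ^+ 2.
  by rewrite -(ler_pM2r n2) -exprD -[X in _ ^+ X](_ : 2 * t = _)%N// /t mulnS addnC.
have c2le : c2 <= tmax ^+ m ^+ r * n%:R ^+ (2 * r).
  have B8 : 0 < 8 * B by rewrite mulr_gt0.
  rewrite exprM -exprMn /c2 lerXn2r ?nnegrE//.
  - by rewrite divr_ge0// ltW.
  - by rewrite mulr_ge0// exprn_ge0// ltW.
  rewrite ler_pdivrMr ?mulr_gt0//; apply: le_trans mge _.
  by rewrite le_eqVlt; apply/orP; left; apply/eqP; ring.
have tr0 : 0 <= tmax ^+ m ^+ r by rewrite !exprn_ge0 ?ltW.
(* Together the bounds give [c2 <= theta^m * T^2], against the choice of [m0]. *)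
have := le_trans c2le (ler_wpM2l tr0 Jle); rewrite leNgt => /negP; apply.
apply: le_lt_trans m0P.
have -> : tmax ^+ m ^+ r * (J%:R ^+ (2 * t) ^+ m * T%:R ^+ 2) =
    theta ^+ m * T%:R ^+ 2.
  by rewrite /theta exprMn -[tmax ^+ m ^+ r]exprM mulnC exprM; ring.
by rewrite ler_wpM2r ?exprn_ge0// ler_wiXn2l//; have /andP[? /ltW] := theta01.
Qed.

Theorem theorem3p3 (R : realType) (d J : nat)
    (f : 'I_J -> 'rV[R]_d -> 'rV[R]_d) (tau : 'I_J -> R)
    (C : set 'rV[R]_d)
    (hJ : (2 <= J)%N)
    (hf : forall j, contracting_similarity (tau j) (f j))
    (hrat : forall j, f j @` rational_vectors R d `<=` rational_vectors R d)
    (hC : is_attractor f C)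
    (hC2 : exists x y : 'rV[R]_d, [/\ C x, C y & x != y])
    (taumax := \big[Num.max/0]_(j < J) tau j)
    (D := - ln (J%:R : R) / ln taumax)
    (hyp : (open_set_condition f /\
            exists v : 'rV[int]_d,
              v != 0 /\ ~ contains_segment_parallel C (map_mx intr v)) \/
           D < 1 / 2) :
  (exists K : R, 0 < K /\
    forall (xi : 'rV[R]_d) (Q : R), C xi -> 1 < Q ->
    exists (p : 'rV[int]_d) (q : nat),
      [/\ (1 <= q)%N, q%:R <= Q,
          (rational_vectors R d `\` C) (ratvec R p q) &
          `|xi - ratvec R p q| <= K / Q]) /\
  (forall Phi : nat -> R,
    (forall n, (1 <= n)%N -> 0 < Phi n) -> Phi @ \oo --> (0 : R) ->
    exists xi : 'rV[R]_d, (C `\` rational_vectors R d) xi /\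
    forall M : nat, exists Q : nat, (M <= Q)%N /\
    forall (p : 'rV[int]_d) (q : nat), (1 <= q <= Q)%N ->
      (rational_vectors R d `\` C) (ratvec R p q) ->
      Phi Q / Q%:R < `|xi - ratvec R p q|) /\
  ((forall Psi : nat -> R, (forall n, (1 <= n)%N -> 0 < Psi n) ->
      exists xi : 'rV[R]_d, intrinsically_approximable C Psi xi) /\
   exists xi : 'rV[R]_d, C xi /\ liouville_vector xi).
Proof.
have [_ cC _] := hC.
split; last split.
- suff [K [N [K0 H]]] : exists (K : R) (N : nat), 0 < K /\
    forall xi n, C xi -> (N <= n)%N -> exists (p : 'rV[int]_d) (q : nat),
      [/\ (1 <= q <= n)%N, ~ C (ratvec R p q) & `|xi - ratvec R p q| <= K / n%:R].
    exact: extrinsic_approx_of_large cC hC2 K0 H.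
  case: hyp => [[osc [v [v0 hv]]]|hD]; first exact: osc_extrinsic hf hC osc v0 hv.
  have tt j : tau j <= taumax by exact: le_bigmax.
  have t0 : 0 < taumax by exact: lt_le_trans (tau_gt0 hf (Ordinal hJ)) (tt _).
  have t1 : taumax < 1 by apply: bigmax_lt => // j _; exact: tau_lt1 hf j.
  apply: (low_dim_extrinsic hf hC hC2 (ltnW hJ) _ tt); first by rewrite t0 t1.
  have J0 : 0 < J%:R :> R by rewrite ltr0n ltnW.
  have lt0 : ln taumax < 0 by rewrite ln_lt0// t0.
  (* Since [ln taumax < 0], [D < 1/2] becomes [2 * ln J + ln taumax < 0], the logarithm of
     [J^2 * taumax < 1]. *)
  move: hD; rewrite /D ltr_ndivrMr// => hD.
  have J2 : 0 < J%:R ^+ 2 :> R by rewrite exprn_gt0.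
  rewrite -ltr_ln ?posrE ?mulr_gt0// ln1 lnM ?posrE// lnXn// mulr2n; lra.
- by move=> Phi _; exact: (extrinsic_not_improvable hf hrat hC hC2).
- split; last exact: (exists_liouville_vector hf hrat hC hC2).
  exact: (exists_intrinsically_approximable hf hrat hC hC2).
Qed.
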